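(* Let $r$ be a positive integer and $n$ a nonnegative integer. Then \begin{multline*} {_{2r+6}\omega_{2r+5}} (ab;c,ab/c,bq,bq^2,\dots,bq^r,aq^n,aq^{n+1},\dots,aq^{n+r-1},q^{-rn};q^r,p) \\ =\frac{(a/c,c/b;q,p)_n\,(q^r,abq^r;q^r,p)_n} {(cq^r,abq^r/c;q^r,p)_n\,(a,1/b;q,p)_n}. \end{multline*}
   Context: Let $p$ be a complex number with $|p|<1$, $q$ a nonzero complex number, and all parameters generic so that no denominator vanishes. For nonzero $x$, $E(x)=E(x;p)=\prod_{k\ge 0}(1-xp^k)(1-p^{k+1}/x)$. For a nonzero base $Q$ and integer $m$, $(a;Q,p)_m=\prod_{k=0}^{m-1}E(aQ^k)$ if $m>0$, $=1$ if $m=0$, and $=1/\prod_{k=0}^{-m-1}E(aQ^{m+k})$ if $m<0$; $(a_1,\dots,a_s;Q,p)_m=\prod_{i=1}^s(a_i;Q,p)_m$. For parameters with $(a_4\cdots a_{r+1})^2=a_1^{r-3}Q^{r-5}$ and one of $a_4,\dots,a_{r+1}$ of the form $Q^{-N}$ ($N$ a nonnegative integer), \[{_{r+1}\omega_r}(a_1;a_4,\dots,a_{r+1};Q,p)=\sum_{k\ge 0}\frac{E(a_1Q^{2k})}{E(a_1)}\frac{(a_1,a_4,\dots,a_{r+1};Q,p)_k\,Q^k}{(Q,a_1Q/a_4,\dots,a_1Q/a_{r+1};Q,p)_k}\] (a terminating sum). *)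

(* Defs.v *)
From Stdlib Require Import Reals List.
From Coquelicot Require Import Coquelicot.
Import ListNotations.
Open Scope C_scope.

(* Limit of a sequence of complex numbers (Coquelicot's [lim] on the
   complete normed module C); it is the limit whenever the sequence converges. *)
Definition limC (u : nat -> C) : C :=
  @lim C_CompleteNormedModule (filtermap u eventually).

Fixpoint Epart (p x : C) (N : nat) : C :=
  match N with
  | O => 1
  | S N' => Epart p x N' * ((1 - x * p ^ N') * (1 - p ^ (S N') / x))
  end.

Definition E (p x : C) : C := limC (Epart p x).

Fixpoint epoch (p Q a : C) (m : nat) : C :=
  match m with
  | O => 1
  | S m' => epoch p Q a m' * E p (a * Q ^ m')
  end.

Definition epochs (p Q : C) (l : list C) (m : nat) : C :=
  fold_right (fun a acc => epoch p Q a m * acc) 1 l.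

Definition omega_den (p Q a1 : C) (l : list C) (k : nat) : C :=
  epoch p Q Q k * epochs p Q (map (fun ai => a1 * Q / ai) l) k.

Definition omega_term (p Q a1 : C) (l : list C) (k : nat) : C :=
  E p (a1 * Q ^ (2 * k)) / E p a1
  * (epoch p Q a1 k * epochs p Q l k * Q ^ k) / omega_den p Q a1 l k.

Fixpoint sum_upto (f : nat -> C) (N : nat) : C :=
  match N with
  | O => f O
  | S N' => sum_upto f N' + f N
  end.

(* The terminating very-well-poised series _{r+1}omega_r(a1; l; Q, p), where
   one of the parameters in l equals Q^{-N}: its terms vanish for k > N, so
   it is the sum of the terms k = 0..N. *)
Definition omega (p Q a1 : C) (l : list C) (N : nat) : C :=
  sum_upto (omega_term p Q a1 l) N.

Definition thm41_params (q a b c : C) (r n : nat) : list C :=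
  [c; a * b / c]
  ++ map (fun j => b * q ^ (S j)) (seq 0 r)
  ++ map (fun j => a * q ^ (n + j)) (seq 0 r)
  ++ [/ q ^ (r * n)].

(* Main.v *)
Require Import Defs.
From Stdlib Require Import Reals List Lra Lia Psatz Permutation ZArith Classical.
From Coquelicot Require Import Coquelicot.
Import ListNotations.
Open Scope C_scope.

(* Put [A = a b], [Q = q ^ r], [R (Y, Z) = E (A Y Z) E (Y / Z)].  Expanding both theta functions by
   the Jacobi triple product and separating the terms of the double series by parity shows that
   [R (Y, Z)] is, up to a factor depending on [Y] only, a 2 x 2 determinant [v (Y) ^ v (Z)].
   Hence Lagrange interpolation on the projective line holds with [R (Y, Z)] in the role of the
   difference [Y - Z].  The summation is this interpolation formula for the product of the
   [R (q ^ j / b, Z)], [0 <= j < n], with nodes [Z = Q ^ k], [0 <= k <= n], evaluated at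
   [Z = 1 / c]: the factors [E (a q ^ j Q ^ k) E (b q ^ (- j) Q ^ k)] reassemble into the [2 r]
   numerator parameters that involve [q ^ j], and [c], [a b / c] come from the evaluation point. *)

(** * Limits of complex sequences *)

(** [E] is only a [limC] of partial products, so its convergence, continuity and zeros all have to
    be established. The classical proof of such an interpolation formula compares zeros and
    quasi-periods of holomorphic functions. Determinants avoid this: the identity becomes algebra in
    the coordinates, where the addition formula for theta functions is the Plücker relation among
    four vectors of the plane. The price is the triple product, obtained as the limit of a finite
    identity, and absolute convergence, which justifies rearranging the double series. The factor in
    front of the determinant does no harm: for the interpolated points it is common to both sides,
    and for the nodes it cancels in quotients. The remaining obstacle is that nonvanishing
    denominators of the series do not make [R (Q ^ i, Q ^ j)] nonzero for distinct nodes. In that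
    case the series still makes sense but interpolation breaks down. Hence the need for convergence
    rates of [E] that are uniform in the argument, for its continuity, and for the location of its
    zeros. *)

Definition Ccv (u : nat -> C) (l : C) : Prop :=
  is_lim_seq (fun n => Cmod (u n - l)) 0%R.

Lemma Cmult_integral (x y : C) : x * y = 0 -> x = 0 \/ y = 0.
Proof.
  intros H; destruct (Ceq_dec x 0) as [-> | Hx]; [now left | right].
  replace y with (/ x * (x * y)) by (field; exact Hx); rewrite H; ring.
Qed.

Lemma Cmod_sym (x y : C) : Cmod (x - y) = Cmod (y - x).
Proof. rewrite <- Cmod_opp; f_equal; ring. Qed.

Lemma Cmod_triangle_inv (x y : C) : (Cmod x - Cmod y <= Cmod (x - y))%R.
Proof.
  pose proof (Cmod_triangle (x - y) y) as H.
  replace (x - y + y) with x in H by ring; lra.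
Qed.

Lemma is_lim_seq_0_le (u v : nat -> R) :
  eventually (fun n => 0 <= u n <= v n)%R -> is_lim_seq v 0%R -> is_lim_seq u 0%R.
Proof.
  intros H Hv; apply (is_lim_seq_le_le_loc (fun _ => 0%R) u v); auto.
  apply is_lim_seq_const.
Qed.

Lemma is_lim_seq_0_spec (u : nat -> R) (eps : R) :
  is_lim_seq u 0%R -> (0 < eps)%R -> exists N, forall n, (N <= n)%nat -> (Rabs (u n) < eps)%R.
Proof.
  intros H He; apply is_lim_seq_spec in H.
  destruct (H (mkposreal eps He)) as [N HN]; exists N; intros n Hn.
  specialize (HN n Hn); simpl in HN; now rewrite Rminus_0_r in HN.
Qed.

Lemma Ccv_spec (u : nat -> C) (l : C) (eps : R) :
  Ccv u l -> (0 < eps)%R -> exists N, forall n, (N <= n)%nat -> (Cmod (u n - l) < eps)%R.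
Proof.
  intros H He; destruct (is_lim_seq_0_spec _ eps H He) as [N HN].
  exists N; intros n Hn; specialize (HN n Hn).
  now rewrite Rabs_pos_eq in HN by apply Cmod_ge_0.
Qed.

Lemma Ccv_intro (u : nat -> C) (l : C) :
  (forall eps : R, (0 < eps)%R ->
     exists N, forall n, (N <= n)%nat -> (Cmod (u n - l) < eps)%R) -> Ccv u l.
Proof.
  intros H; apply is_lim_seq_spec; intros eps.
  destruct (H eps (cond_pos eps)) as [N HN]; exists N; intros n Hn.
  rewrite Rminus_0_r, Rabs_pos_eq by apply Cmod_ge_0; auto.
Qed.

Lemma Ccv_le (u : nat -> C) (l : C) (v : nat -> R) :
  eventually (fun n => Cmod (u n - l) <= v n)%R -> is_lim_seq v 0%R -> Ccv u l.
Proof.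
  intros [N HN]; apply is_lim_seq_0_le; exists N; intros n Hn.
  split; [apply Cmod_ge_0 | auto].
Qed.

Lemma Ccv_ext_loc (u v : nat -> C) (l : C) :
  eventually (fun n => u n = v n) -> Ccv u l -> Ccv v l.
Proof.
  intros [N HN] H; apply (is_lim_seq_ext_loc (fun n => Cmod (u n - l))); auto.
  exists N; intros n Hn; now rewrite HN.
Qed.

Lemma Ccv_ext (u v : nat -> C) (l : C) : (forall n, u n = v n) -> Ccv u l -> Ccv v l.
Proof. intros H; apply Ccv_ext_loc; exists O; auto. Qed.

Lemma Ccv_const (l : C) : Ccv (fun _ => l) l.
Proof.
  apply Ccv_le with (fun _ => 0%R); [| apply is_lim_seq_const].
  exists O; intros _ _; replace (l - l) with (RtoC 0) by ring; rewrite Cmod_0; lra.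
Qed.

Lemma Ccv_Cmod (u : nat -> C) (l : C) : Ccv u l -> is_lim_seq (fun n => Cmod (u n)) (Cmod l).
Proof.
  intros H; apply is_lim_seq_spec; intros eps.
  destruct (Ccv_spec u l eps H (cond_pos eps)) as [N HN]; exists N; intros n Hn.
  specialize (HN n Hn).
  pose proof (Cmod_triangle_inv (u n) l); pose proof (Cmod_triangle_inv l (u n)).
  rewrite (Cmod_sym l) in *; apply Rabs_def1; lra.
Qed.

Lemma Ccv_plus (u v : nat -> C) (l m : C) :
  Ccv u l -> Ccv v m -> Ccv (fun n => u n + v n) (l + m).
Proof.
  intros Hu Hv; eapply Ccv_le; [| rewrite <- (Rplus_0_r 0);
    apply (is_lim_seq_plus' _ _ _ _ Hu Hv)].
  exists O; intros n _; replace (u n + v n - (l + m)) with (u n - l + (v n - m)) by ring.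
  apply Cmod_triangle.
Qed.

Lemma Ccv_mult (u v : nat -> C) (l m : C) :
  Ccv u l -> Ccv v m -> Ccv (fun n => u n * v n) (l * m).
Proof.
  intros Hu Hv.
  apply Ccv_le with (fun n => Cmod (u n - l) * Cmod (v n) + Cmod l * Cmod (v n - m))%R.
  - exists O; intros n _.
    replace (u n * v n - l * m) with ((u n - l) * v n + l * (v n - m)) by ring.
    eapply Rle_trans; [apply Cmod_triangle |]; rewrite !Cmod_mult; lra.
  - replace 0%R with (0 * Cmod m + Cmod l * 0)%R by ring.
    apply is_lim_seq_plus'; apply is_lim_seq_mult'; auto using is_lim_seq_const, Ccv_Cmod.
Qed.

Lemma Ccv_inv (u : nat -> C) (l : C) : l <> 0 -> Ccv u l -> Ccv (fun n => / u n) (/ l).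
Proof.
  intros Hl Hu.
  assert (Hl' : (0 < Cmod l)%R) by now apply Cmod_gt_0.
  apply Ccv_le with (fun n => Cmod (u n - l) / (Cmod (u n) * Cmod l))%R.
  - destruct (Ccv_spec u l (Cmod l) Hu Hl') as [N HN]; exists N; intros n Hn.
    specialize (HN n Hn).
    assert (Hn0 : u n <> 0).
    { intros E0; rewrite E0 in HN; replace (0 - l) with (- l) in HN by ring.
      rewrite Cmod_opp in HN; lra. }
    replace (/ u n - / l) with (- ((u n - l) / (u n * l))) by (field; auto).
    rewrite Cmod_opp, Cmod_div, Cmod_mult; [lra |].
    intros E0; now apply (Cmult_neq_0 (u n) l).
  - replace 0%R with (0 / (Cmod l * Cmod l))%R by (field; lra).
    apply is_lim_seq_div'; auto.
    + apply is_lim_seq_mult'; [now apply Ccv_Cmod | apply is_lim_seq_const].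
    + nra.
Qed.

Lemma Ccv_div (u v : nat -> C) (l m : C) :
  m <> 0 -> Ccv u l -> Ccv v m -> Ccv (fun n => u n / v n) (l / m).
Proof. intros Hm Hu Hv; apply Ccv_mult; auto using Ccv_inv. Qed.

Lemma Ccv_opp (u : nat -> C) (l : C) : Ccv u l -> Ccv (fun n => - u n) (- l).
Proof.
  intros H; apply (Ccv_ext (fun n => - (1) * u n)); [intros; ring |].
  replace (- l) with (- (1) * l) by ring; apply Ccv_mult; auto using Ccv_const.
Qed.

Lemma Ccv_minus (u v : nat -> C) (l m : C) :
  Ccv u l -> Ccv v m -> Ccv (fun n => u n - v n) (l - m).
Proof. intros Hu Hv; apply Ccv_plus; auto using Ccv_opp. Qed.

Lemma Ccv_subseq (u : nat -> C) (l : C) (phi : nat -> nat) :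
  (forall N, exists M, forall n, (M <= n)%nat -> (N <= phi n)%nat) ->
  Ccv u l -> Ccv (fun n => u (phi n)) l.
Proof.
  intros Hphi H; apply Ccv_intro; intros eps He.
  destruct (Ccv_spec u l eps H He) as [N HN], (Hphi N) as [M HM].
  exists M; intros n Hn; apply HN, HM, Hn.
Qed.

Lemma Ccv_unique (u : nat -> C) (l m : C) : Ccv u l -> Ccv u m -> l = m.
Proof.
  intros Hl Hm.
  assert (H : Ccv (fun n => u n - u n) (l - m)) by now apply Ccv_minus.
  apply (Ccv_ext _ (fun _ => 0)) in H; [| intros; ring].
  pose proof (is_lim_seq_unique _ _ H) as H0; cbv beta in H0; rewrite Lim_seq_const in H0.
  injection H0 as H0; apply Cmod_eq_0 in H0.
  replace l with (m - (0 - (l - m))) by ring; rewrite H0; ring.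
Qed.

Lemma Ccv_nonzero (u : nat -> C) (l : C) :
  l <> 0 -> Ccv u l -> eventually (fun n => u n <> 0).
Proof.
  intros Hl Hu; assert (Hl' : (0 < Cmod l)%R) by now apply Cmod_gt_0.
  destruct (Ccv_spec u l (Cmod l) Hu Hl') as [N HN]; exists N; intros n Hn E0.
  specialize (HN n Hn); rewrite E0 in HN; replace (0 - l) with (- l) in HN by ring.
  rewrite Cmod_opp in HN; lra.
Qed.

Lemma cauchy_Ccv_limC (u : nat -> C) :
  (forall eps : R, (0 < eps)%R ->
     exists N, forall n, (N <= n)%nat -> (Cmod (u n - u N) < eps)%R) ->
  Ccv u (limC u).
Proof.
  intros H; unfold limC.
  assert (HP : ProperFilter (filtermap u eventually)) by apply filtermap_proper_filter, eventually_filter.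
  assert (HC : @cauchy C_UniformSpace (filtermap u eventually)).
  { intros eps; destruct (H eps (cond_pos eps)) as [N HN]; exists (u N), N.
    intros n Hn; apply C_NormedModule_mixin_compat1, HN, Hn. }
  pose proof (@complete_cauchy C_CompleteNormedModule _ HP HC) as HL.
  apply Ccv_intro; intros eps He.
  assert (H2 : (0 < sqrt 2)%R) by (apply sqrt_lt_R0; lra).
  (* Balls in [C] are taken coordinatewise, so passing to [Cmod] costs a factor [sqrt 2]. *)
  assert (He' : (0 < eps / sqrt 2)%R) by now apply Rdiv_lt_0_compat.
  destruct (HL (mkposreal _ He')) as [N HN]; exists N; intros n Hn.
  specialize (HN n Hn).
  apply (C_NormedModule_mixin_compat2 _ _ (mkposreal _ He')) in HN; simpl in HN.
  replace (sqrt 2 * (eps / sqrt 2))%R with eps in HN by (field; lra).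
  exact HN.
Qed.

Lemma Ccv_limC (u : nat -> C) (l : C) : Ccv u l -> limC u = l.
Proof.
  intros H; apply Ccv_unique with u; auto.
  apply cauchy_Ccv_limC; intros eps He.
  destruct (Ccv_spec u l (eps / 2) H ltac:(lra)) as [N HN]; exists N; intros n Hn.
  pose proof (HN n Hn); pose proof (HN N (le_n N)).
  replace (u n - u N) with ((u n - l) - (u N - l)) by ring.
  pose proof (Cmod_triangle (u n - l) (- (u N - l))); rewrite Cmod_opp in *.
  unfold Cminus at 1; lra.
Qed.

(** * Infinite products *)

Lemma Ccv_bounded (u : nat -> C) (l : C) :
  Ccv u l -> exists B : R, (0 < B)%R /\ forall n, (Cmod (u n) <= B)%R.
Proof.
  intros H; destruct (Ccv_spec u l 1 H ltac:(lra)) as [N HN].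
  assert (Hfin : exists B : R, (0 < B)%R /\ forall n, (n < N)%nat -> (Cmod (u n) <= B)%R).
  { clear; induction N as [| N [B [HB IH]]].
    - exists 1%R; split; [lra | intros; lia].
    - exists (Rmax B (Cmod (u N))); split; [pose proof (Rmax_l B (Cmod (u N))); lra |].
      intros n Hn; destruct (Nat.eq_dec n N) as [-> | Hne]; [apply Rmax_r |].
      eapply Rle_trans; [apply IH; lia | apply Rmax_l]. }
  destruct Hfin as [B [HB0 HB]]; exists (Rmax B (Cmod l + 1)); split.
  - pose proof (Rmax_l B (Cmod l + 1)); lra.
  - intros n; destruct (Nat.lt_ge_cases n N) as [Hn | Hn].
    + eapply Rle_trans; [apply HB, Hn | apply Rmax_l].
    + eapply Rle_trans; [| apply Rmax_r].
      pose proof (HN n Hn); pose proof (Cmod_triangle_inv (u n) l); lra.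
Qed.

Fixpoint cprod (f : nat -> C) (n : nat) : C :=
  match n with
  | O => 1
  | S m => cprod f m * f m
  end.

Lemma Rpow_01 (rho : R) (n : nat) : (0 <= rho < 1)%R -> (0 <= rho ^ n <= 1)%R.
Proof.
  intros H; split; [apply pow_le; lra |].
  rewrite <- (pow1 n); apply pow_incr; lra.
Qed.

Lemma geom_partial (K rho : R) (n : nat) : (rho < 1)%R ->
  (K * (1 - rho ^ n) / (1 - rho) + K * rho ^ n = K * (1 - rho ^ S n) / (1 - rho))%R.
Proof. intros H; simpl; field; lra. Qed.

Lemma geom_partial_le (K rho : R) (n : nat) : (0 <= K)%R -> (0 <= rho < 1)%R ->
  (0 <= K * (1 - rho ^ n) / (1 - rho) <= K / (1 - rho))%R.
Proof.
  intros HK Hr; pose proof (Rpow_01 rho n Hr).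
  assert (0 < / (1 - rho))%R by (apply Rinv_0_lt_compat; lra).
  unfold Rdiv; split.
  - apply Rmult_le_pos; [apply Rmult_le_pos |]; lra.
  - apply Rmult_le_compat_r; nra.
Qed.

Section InfiniteProduct.
Context (u : nat -> C) (K rho : R).
Context (HK : (0 <= K)%R) (Hrho : (0 <= rho < 1)%R).
Context (Hu : forall k, (Cmod (u k) <= K * rho ^ k)%R).

Let f k := 1 - u k.

Lemma Cmod_factor_le (k : nat) : (Cmod (f k) <= 1 + K * rho ^ k)%R.
Proof.
  unfold f, Cminus; eapply Rle_trans; [apply Cmod_triangle |].
  rewrite Cmod_opp, Cmod_1; pose proof (Hu k); lra.
Qed.

Lemma cprod_bounded (n : nat) : (Cmod (cprod f n) <= exp (K / (1 - rho)))%R.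
Proof.
  apply Rle_trans with (exp (K * (1 - rho ^ n) / (1 - rho))).
  - induction n as [| n IH].
    + simpl; rewrite Cmod_1; replace (K * (1 - 1) / (1 - rho))%R with 0%R by (field; lra).
      rewrite exp_0; lra.
    + rewrite <- geom_partial, exp_plus by lra; simpl cprod; rewrite Cmod_mult.
      apply Rmult_le_compat; try apply Cmod_ge_0; auto.
      eapply Rle_trans; [apply Cmod_factor_le | apply exp_ineq1_le].
  - destruct (geom_partial_le K rho n HK Hrho) as [_ [H | ->]]; [| lra].
    left; now apply exp_increasing.
Qed.

Let M := (exp (K / (1 - rho)) * (K / (1 - rho)))%R.

(** One more factor changes the product by [- cprod f k * u k]; with the uniform bound on partial
    products these increments form a geometric tail. [M] depends on [K] and [rho] alone, which later
    gives rates for [E] uniform in its argument. *)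
Lemma cprod_diff (n m : nat) : (n <= m)%nat ->
  (Cmod (cprod f m - cprod f n) <= M * rho ^ n)%R.
Proof.
  intros Hnm; replace m with (n + (m - n))%nat by lia.
  generalize (m - n)%nat as j; clear m Hnm; intros j; unfold M.
  pose proof (exp_pos (K / (1 - rho))) as He.
  pose proof (Rpow_01 rho n Hrho) as Hn.
  apply Rle_trans with
    (exp (K / (1 - rho)) * (K * rho ^ n * (1 - rho ^ j) / (1 - rho)))%R.
  - induction j as [| j IH].
    + rewrite Nat.add_0_r; replace (cprod f n - cprod f n) with (RtoC 0) by ring.
      rewrite Cmod_0; simpl; right; field; lra.
    + rewrite Nat.add_succ_r, <- geom_partial by lra; simpl cprod.
      replace (cprod f (n + j) * f (n + j) - cprod f n) with
        ((cprod f (n + j) - cprod f n) - cprod f (n + j) * u (n + j)%nat)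
        by (unfold f; ring).
      unfold Cminus at 1; eapply Rle_trans; [apply Cmod_triangle |].
      rewrite Cmod_opp, Cmod_mult, Rmult_plus_distr_l.
      apply Rplus_le_compat; auto.
      apply Rmult_le_compat; try apply Cmod_ge_0; [apply cprod_bounded |].
      eapply Rle_trans; [apply Hu |]; rewrite pow_add; lra.
  - rewrite (Rmult_assoc _ (K / (1 - rho)) (rho ^ n)); apply Rmult_le_compat_l; [lra |].
    eapply Rle_trans; [apply geom_partial_le; auto; apply Rmult_le_pos; lra |].
    right; field; lra.
Qed.

Lemma pow_scaled_lim (B : R) : is_lim_seq (fun n => B * rho ^ n)%R 0%R.
Proof.
  replace (Finite 0) with (Finite (B * 0)) by (f_equal; ring).
  apply is_lim_seq_mult'; [apply is_lim_seq_const | apply is_lim_seq_geom].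
  rewrite Rabs_pos_eq; lra.
Qed.

Lemma cprod_cv : Ccv (cprod f) (limC (cprod f)).
Proof.
  apply cauchy_Ccv_limC; intros eps He.
  destruct (is_lim_seq_0_spec _ eps (pow_scaled_lim M) He) as [N HN]; exists N.
  intros n Hn; eapply Rle_lt_trans; [apply cprod_diff, Hn |].
  eapply Rle_lt_trans; [apply Rle_abs | apply HN; lia].
Qed.

Lemma cprod_rate (n : nat) : (Cmod (limC (cprod f) - cprod f n) <= M * rho ^ n)%R.
Proof.
  pose proof (Ccv_Cmod _ _ (Ccv_minus _ _ _ _ cprod_cv (Ccv_const (cprod f n)))) as H.
  refine (is_lim_seq_le_loc _ (fun _ => M * rho ^ n)%R _ (Finite (M * rho ^ n)) _ H
            (is_lim_seq_const _)).
  exists n; intros m Hm; apply cprod_diff, Hm.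
Qed.

Lemma cprod_nonzero (n : nat) : (forall k, f k <> 0) -> cprod f n <> 0.
Proof.
  intros Hf; induction n as [| n IH]; simpl.
  - intros H; apply RtoC_inj in H; lra.
  - apply Cmult_neq_0; auto.
Qed.

(** Beyond an index [N] where the tail sum of the deviations is below 1/2, the inequality
    [(1 - s) * (1 - t) >= 1 - s - t] keeps the partial products at least half as large as the
    nonzero [cprod f N]. *)
Lemma infinite_product_nonzero : (forall k, f k <> 0) -> limC (cprod f) <> 0.
Proof.
  intros Hf.
  assert (Hd : (0 < 1 - rho)%R) by lra.
  destruct (is_lim_seq_0_spec _ (/ 2) (pow_scaled_lim (K / (1 - rho))) ltac:(lra)) as [N HN].
  specialize (HN N (le_n N)).
  pose proof (Rpow_01 rho N Hrho) as HrN.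
  assert (HKd : (0 <= K / (1 - rho))%R)
    by (apply Rmult_le_pos; auto; left; now apply Rinv_0_lt_compat).
  rewrite Rabs_pos_eq in HN by (apply Rmult_le_pos; lra).
  assert (HKN : (0 <= K * rho ^ N)%R) by (apply Rmult_le_pos; lra).
  assert (Hc : (0 < Cmod (cprod f N))%R) by now apply Cmod_gt_0, cprod_nonzero.
  assert (Hs : forall m, (0 <= K * rho ^ N * (1 - rho ^ m) / (1 - rho) <= / 2)%R).
  { intros m; destruct (geom_partial_le _ rho m HKN Hrho) as [H1 H2]; split; auto.
    replace (K * rho ^ N / (1 - rho))%R with (K / (1 - rho) * rho ^ N)%R in H2
      by (field; lra); lra. }
  assert (Hlow : forall m, (Cmod (cprod f N) * (1 - K * rho ^ N * (1 - rho ^ m) / (1 - rho))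
                            <= Cmod (cprod f (N + m)))%R).
  { induction m as [| m IH].
    - rewrite Nat.add_0_r; simpl; right; field; lra.
    - rewrite Nat.add_succ_r, <- geom_partial by lra; simpl cprod; rewrite Cmod_mult.
      pose proof (Hs m) as H1; pose proof (Hs (S m)) as H2.
      rewrite <- geom_partial in H2 by lra.
      assert (H3 : (1 - K * rho ^ N * rho ^ m <= Cmod (f (N + m)))%R).
      { pose proof (Cmod_triangle_inv 1 (u (N + m)%nat)) as H4; rewrite Cmod_1 in H4.
        pose proof (Hu (N + m)) as H5; rewrite pow_add in H5.
        change (Cmod (f (N + m))) with (Cmod (1 - u (N + m)%nat)); lra. }
      pose proof (Rpow_01 rho m Hrho).
      assert (H6 : (0 <= K * rho ^ N * rho ^ m)%R) by (apply Rmult_le_pos; lra).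
      set (s := (K * rho ^ N * (1 - rho ^ m) / (1 - rho))%R) in *.
      set (t := (K * rho ^ N * rho ^ m)%R) in *.
      apply Rle_trans with (Cmod (cprod f N) * (1 - s) * (1 - t))%R.
      + assert (0 <= Cmod (cprod f N) * (s * t))%R
          by (apply Rmult_le_pos; [lra |]; apply Rmult_le_pos; [exact (proj1 H1) | exact H6]); lra.
      + apply Rmult_le_compat; [apply Rmult_le_pos; lra | lra | exact IH | exact H3]. }
  intros H0.
  pose proof cprod_cv as Hcv; rewrite H0 in Hcv.
  destruct (Ccv_spec _ _ (Cmod (cprod f N) / 2) Hcv ltac:(lra)) as [m Hm].
  specialize (Hm (N + m)%nat ltac:(lia)).
  replace (cprod f (N + m) - 0) with (cprod f (N + m)) in Hm by ring.
  pose proof (Hlow m); pose proof (Hs m); nra.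
Qed.
End InfiniteProduct.

(** * The modified theta function *)

Lemma cprod_ext (f g : nat -> C) (n : nat) :
  (forall k, (k < n)%nat -> f k = g k) -> cprod f n = cprod g n.
Proof.
  intros H; induction n as [| n IH]; simpl; auto.
  rewrite IH, H by auto; reflexivity.
Qed.

(** The two factors of index [k] are multiplied out to [1 - Efactor_dev p x k], which makes [E] a
    single product whose deviations from 1 decay like [Cmod p ^ k]. *)
Definition Efactor_dev (p x : C) (k : nat) : C :=
  x * p ^ k + p ^ S k / x - p ^ k * p ^ S k.

Lemma Epart_cprod (p x : C) (N : nat) : x <> 0 ->
  Epart p x N = cprod (fun k => 1 - Efactor_dev p x k) N.
Proof.
  intros Hx; induction N as [| N IH]; simpl; auto.
  rewrite IH; unfold Efactor_dev; f_equal; rewrite Cpow_S; field; exact Hx.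
Qed.

Lemma Cmod_Cpow_S_le (p : C) (k : nat) : (Cmod p < 1)%R -> (Cmod (p ^ S k) <= Cmod p ^ k)%R.
Proof.
  intros Hp; rewrite Cmod_pow; simpl.
  pose proof (Rpow_01 (Cmod p) k (conj (Cmod_ge_0 p) Hp)); pose proof (Cmod_ge_0 p); nra.
Qed.

Lemma Efactor_dev_le (p x : C) (B : R) (k : nat) : (Cmod p < 1)%R ->
  (Cmod x <= B)%R -> (Cmod (/ x) <= B)%R ->
  (Cmod (Efactor_dev p x k) <= (2 * B + 1) * Cmod p ^ k)%R.
Proof.
  intros Hp H1 H2; unfold Efactor_dev, Cminus, Cdiv.
  pose proof (Rpow_01 (Cmod p) k (conj (Cmod_ge_0 p) Hp)) as Hk.
  pose proof (Cmod_Cpow_S_le p k Hp) as HS; pose proof (Cmod_ge_0 (p ^ S k)).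
  eapply Rle_trans; [apply Cmod_triangle |].
  eapply Rle_trans; [apply Rplus_le_compat_r, Cmod_triangle |].
  rewrite Cmod_opp, !Cmod_mult, (Cmod_pow p k).
  pose proof (Cmod_ge_0 x); pose proof (Cmod_ge_0 (/ x)).
  assert (Cmod x * Cmod p ^ k <= B * Cmod p ^ k)%R by (apply Rmult_le_compat_r; lra).
  assert (Cmod (p ^ S k) * Cmod (/ x) <= Cmod p ^ k * B)%R by (apply Rmult_le_compat; lra).
  assert (Cmod p ^ k * Cmod (p ^ S k) <= 1 * Cmod p ^ k)%R by (apply Rmult_le_compat; lra).
  lra.
Qed.

Lemma E_limC_cprod (p x : C) : (Cmod p < 1)%R -> x <> 0 ->
  Ccv (Epart p x) (limC (cprod (fun k => 1 - Efactor_dev p x k))).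
Proof.
  intros Hp Hx; set (B := Rmax (Cmod x) (Cmod (/ x))).
  apply (Ccv_ext (cprod (fun k => 1 - Efactor_dev p x k)));
    [intros n; symmetry; now apply Epart_cprod |].
  pose proof (Cmod_ge_0 x); pose proof (Rmax_l (Cmod x) (Cmod (/ x))).
  refine (cprod_cv _ (2 * B + 1) (Cmod p) _ _ _); [unfold B; lra | split; auto using Cmod_ge_0 |].
  intros k; apply Efactor_dev_le; [exact Hp | apply Rmax_l | apply Rmax_r].
Qed.

Lemma E_eq_limC_cprod (p x : C) : (Cmod p < 1)%R -> x <> 0 ->
  E p x = limC (cprod (fun k => 1 - Efactor_dev p x k)).
Proof. intros Hp Hx; now apply Ccv_limC, E_limC_cprod. Qed.

Lemma Epart_cv (p x : C) : (Cmod p < 1)%R -> x <> 0 -> Ccv (Epart p x) (E p x).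
Proof. intros Hp Hx; rewrite E_eq_limC_cprod by auto; now apply E_limC_cprod. Qed.

(** [M] is chosen before [x]: on the annulus [1 / B <= Cmod x <= B] the deviations have a common
    geometric bound. This uniformity transfers continuity from the partial products to [E]. *)
Lemma Epart_rate (p : C) (B : R) : (Cmod p < 1)%R -> (0 <= B)%R ->
  exists M : R, forall (x : C) (N : nat), x <> 0 -> (Cmod x <= B)%R -> (Cmod (/ x) <= B)%R ->
    (Cmod (E p x - Epart p x N) <= M * Cmod p ^ N)%R.
Proof.
  intros Hp HB; eexists; intros x N Hx H1 H2.
  rewrite (E_eq_limC_cprod p x Hp Hx), (Epart_cprod p x N Hx).
  apply (cprod_rate (Efactor_dev p x) (2 * B + 1) (Cmod p)); [lra | split; auto using Cmod_ge_0 |].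
  intros k; now apply Efactor_dev_le.
Qed.

Lemma E_zero (p x : C) : (Cmod p < 1)%R -> x <> 0 -> E p x = 0 ->
  exists k, x * p ^ k = 1 \/ x = p ^ S k.
Proof.
  intros Hp Hx H0; apply NNPP; intros Hn; revert H0.
  rewrite E_eq_limC_cprod by auto; set (B := Rmax (Cmod x) (Cmod (/ x))).
  pose proof (Cmod_ge_0 x); pose proof (Rmax_l (Cmod x) (Cmod (/ x))).
  refine (infinite_product_nonzero _ (2 * B + 1) (Cmod p) _ _ _ _);
    [unfold B; lra | split; auto using Cmod_ge_0 | |].
  - intros k; apply Efactor_dev_le; [exact Hp | apply Rmax_l | apply Rmax_r].
  - intros k Hk.
    replace (1 - Efactor_dev p x k) with ((1 - x * p ^ k) * (1 - p ^ S k / x)) in Hk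
      by (unfold Efactor_dev; field; auto).
    apply Hn; exists k; apply Cmult_integral in Hk; destruct Hk as [Hk | Hk]; [left | right].
    + replace (x * p ^ k) with (1 - (1 - x * p ^ k)) by ring; rewrite Hk; ring.
    + replace (p ^ S k) with (x - x * (1 - p ^ S k / x)) by (field; auto).
      rewrite Hk; ring.
Qed.

Lemma Epart_continuous (p : C) (N : nat) (u : nat -> C) (l : C) : l <> 0 ->
  Ccv u l -> Ccv (fun n => Epart p (u n) N) (Epart p l N).
Proof.
  intros Hl Hu; induction N as [| N IH]; simpl; [apply Ccv_const |].
  repeat first [apply Ccv_const | apply Ccv_minus | apply Ccv_div | apply Ccv_mult | assumption].
Qed.

Lemma E_continuous (p : C) (u : nat -> C) (l : C) : (Cmod p < 1)%R -> l <> 0 ->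
  Ccv u l -> Ccv (fun n => E p (u n)) (E p l).
Proof.
  (* The extra 1 is a margin: [u n] and [/ u n] stay below [B] as soon as they are within 1 of their
     limits. *)
  intros Hp Hl Hu; set (B := (Cmod l + Cmod (/ l) + 1)%R).
  pose proof (Cmod_ge_0 l); pose proof (Cmod_ge_0 (/ l)).
  destruct (Epart_rate p B Hp ltac:(unfold B; lra)) as [M HM].
  apply Ccv_intro; intros eps He.
  assert (Hp' : (0 <= Cmod p < 1)%R) by (split; auto using Cmod_ge_0).
  destruct (is_lim_seq_0_spec _ (eps / 3) (pow_scaled_lim _ Hp' M) ltac:(lra)) as [N HN].
  specialize (HN N (le_n N)); apply Rabs_def2 in HN.
  destruct (Ccv_spec _ _ (eps / 3) (Epart_continuous p N u l Hl Hu) ltac:(lra)) as [N1 H1].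
  destruct (Ccv_spec _ _ 1 Hu ltac:(lra)) as [N2 H2].
  destruct (Ccv_spec _ _ 1 (Ccv_inv _ _ Hl Hu) ltac:(lra)) as [N3 H3].
  destruct (Ccv_nonzero _ _ Hl Hu) as [N4 H4].
  exists (N1 + N2 + N3 + N4)%nat; intros n Hn.
  specialize (H1 n ltac:(lia)); specialize (H2 n ltac:(lia)).
  specialize (H3 n ltac:(lia)); specialize (H4 n ltac:(lia)).
  pose proof (Cmod_triangle_inv (u n) l); pose proof (Cmod_triangle_inv (/ u n) (/ l)).
  pose proof (HM (u n) N H4 ltac:(unfold B; lra) ltac:(unfold B; lra)) as Hun.
  pose proof (HM l N Hl ltac:(unfold B; lra) ltac:(unfold B; lra)) as Hlim.
  rewrite Cmod_sym in Hlim.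
  replace (E p (u n) - E p l) with
    (E p (u n) - Epart p (u n) N + (Epart p (u n) N - Epart p l N) + (Epart p l N - E p l)) by ring.
  pose proof (Cmod_triangle (E p (u n) - Epart p (u n) N + (Epart p (u n) N - Epart p l N))
                (Epart p l N - E p l)).
  pose proof (Cmod_triangle (E p (u n) - Epart p (u n) N) (Epart p (u n) N - Epart p l N)).
  lra.
Qed.

Lemma Cpow_cv_0 (p : C) : (Cmod p < 1)%R -> Ccv (fun n => p ^ n) 0.
Proof.
  intros Hp; apply Ccv_le with (fun n => 1 * Cmod p ^ n)%R.
  - exists O; intros n _; replace (p ^ n - 0) with (p ^ n) by ring; rewrite Cmod_pow; lra.
  - apply pow_scaled_lim; split; auto using Cmod_ge_0.
Qed.

(** With one extra factor on each side the identity already holds for partial products, both sides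
    being [(1 - 1 / x)] times the product of [(1 - p ^ k / x) * (1 - p ^ k * x)] over [1 <= k <= N].
    The extra factors tend to 1. *)
Lemma E_inv (p x : C) : (Cmod p < 1)%R -> x <> 0 -> E p (/ x) = - (E p x / x).
Proof.
  intros Hp Hx.
  assert (Hx' : / x <> 0).
  { intros H0; apply Hx; replace x with (x * x * / x) by (field; auto); rewrite H0; ring. }
  apply Ccv_unique with (fun N => Epart p (/ x) N * (1 - p ^ N / x)).
  - replace (E p (/ x)) with (E p (/ x) * (1 - 0 / x)) by (field; auto).
    apply Ccv_mult; [now apply Epart_cv |].
    repeat first [apply Ccv_const | apply Ccv_minus | apply Ccv_div | apply Cpow_cv_0 | assumption].
  - apply (Ccv_ext (fun N => - (/ x) * Epart p x N * (1 - p ^ N * x))).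
    + intros N; induction N as [| N IH]; [simpl; field; auto |].
      cbn [Epart]; rewrite Cpow_S in *.
      transitivity (- / x * Epart p x N * (1 - p ^ N * x)
                    * ((1 - p * p ^ N / x) * (1 - p * p ^ N * x))); [ring |].
      rewrite IH; field; auto.
    + replace (- (E p x / x)) with (- (/ x) * E p x * (1 - 0 * x)) by (field; auto).
      repeat first [apply Ccv_const | apply Ccv_minus | apply Ccv_mult | apply Cpow_cv_0
                   | apply Epart_cv | assumption].
Qed.

(** * Sums over the integers *)

Definition zpow (x : C) (j : Z) : C :=
  if (0 <=? j)%Z then x ^ Z.to_nat j else / x ^ Z.to_nat (- j).

Lemma C1_neq_0 : RtoC 1 <> 0.
Proof. intros H; apply RtoC_inj in H; lra. Qed.

Lemma Cinv_neq_0 (x : C) : x <> 0 -> / x <> 0.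
Proof.
  intros Hx H0; apply C1_neq_0; rewrite <- (Cinv_r x Hx), H0; ring.
Qed.

Lemma zpow_succ (x : C) (j : Z) : x <> 0 -> zpow x (j + 1) = x * zpow x j.
Proof.
  intros Hx; unfold zpow.
  destruct (Z.leb_spec 0 j), (Z.leb_spec 0 (j + 1)); try lia.
  - now rewrite Z2Nat.inj_add, Nat.add_1_r, Cpow_S by lia.
  - replace j with (-1)%Z by lia; simpl; field; exact Hx.
  - replace (Z.to_nat (- j)) with (S (Z.to_nat (- (j + 1)))) by lia.
    rewrite Cpow_S; field; split; auto; now apply Cpow_nz.
Qed.

Lemma zpow_0 (x : C) : zpow x 0 = 1.
Proof. reflexivity. Qed.

Lemma zpow_pred (x : C) (j : Z) : x <> 0 -> zpow x j = x * zpow x (j - 1).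
Proof. intros Hx; rewrite <- zpow_succ by auto; f_equal; lia. Qed.

(** Uniqueness for a first-order recurrence on the integers; the laws of exponents follow from it
    without case distinctions on signs. *)
Lemma zpow_characterization (x : C) (f : Z -> C) : x <> 0 ->
  f 0%Z = 1 -> (forall j, f (j + 1)%Z = x * f j) -> forall j, f j = zpow x j.
Proof.
  intros Hx H0 HS j; induction j as [| j IH | j IH] using Z.peano_ind.
  - exact H0.
  - unfold Z.succ; now rewrite HS, zpow_succ, IH.
  - assert (H := HS (Z.pred j)); replace (Z.pred j + 1)%Z with j in H by lia.
    rewrite IH, (zpow_pred x j Hx) in H; replace (j - 1)%Z with (Z.pred j) in H by lia.
    replace (f (Z.pred j)) with (/ x * (x * f (Z.pred j))) by (field; auto).
    rewrite <- H; field; auto.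
Qed.

Lemma zpow_neq_0 (x : C) (j : Z) : x <> 0 -> zpow x j <> 0.
Proof.
  intros Hx; unfold zpow; destruct (0 <=? j)%Z; [| apply Cinv_neq_0]; now apply Cpow_nz.
Qed.

Lemma zpow_add (x : C) (i j : Z) : x <> 0 -> zpow x (i + j) = zpow x i * zpow x j.
Proof.
  intros Hx; assert (Hi : zpow x i <> 0) by now apply zpow_neq_0.
  assert (H : zpow x (i + j) / zpow x i = zpow x j).
  { apply (zpow_characterization x (fun j => zpow x (i + j) / zpow x i) Hx).
    - rewrite Z.add_0_r; field; exact Hi.
    - intros k; rewrite Z.add_assoc, zpow_succ by auto; field; exact Hi. }
  rewrite <- H; field; exact Hi.
Qed.

Lemma zpow_opp (x : C) (j : Z) : x <> 0 -> zpow x (- j) = / zpow x j.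
Proof.
  intros Hx; assert (H := zpow_add x j (- j) Hx); rewrite Z.add_opp_diag_r, zpow_0 in H.
  pose proof (zpow_neq_0 x j Hx).
  replace (zpow x (- j)) with (/ zpow x j * (zpow x j * zpow x (- j))) by (field; auto).
  rewrite <- H; ring.
Qed.

Lemma zpow_mult (x y : C) (j : Z) : x <> 0 -> y <> 0 -> zpow (x * y) j = zpow x j * zpow y j.
Proof.
  intros Hx Hy; symmetry.
  apply (zpow_characterization (x * y) (fun j => zpow x j * zpow y j));
    [now apply Cmult_neq_0 | rewrite !zpow_0; ring |].
  intros k; rewrite !zpow_succ by auto; ring.
Qed.

Lemma zpow_div (x y : C) (j : Z) : x <> 0 -> y <> 0 -> zpow (x / y) j = zpow x j * zpow y (- j).
Proof.
  intros Hx Hy; symmetry; rewrite zpow_opp by auto.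
  apply (zpow_characterization (x / y) (fun j => zpow x j * / zpow y j));
    [apply Cmult_neq_0; auto using Cinv_neq_0 | rewrite !zpow_0; field; apply C1_neq_0 |].
  intros k; rewrite !zpow_succ by auto; field; split; auto using zpow_neq_0.
Qed.

Lemma Cmod_zpow_le (x : C) (B : R) (j : Z) : x <> 0 ->
  (Cmod x <= B)%R -> (Cmod (/ x) <= B)%R -> (Cmod (zpow x j) <= B ^ Z.abs_nat j)%R.
Proof.
  intros Hx H1 H2; unfold zpow; destruct (Z.leb_spec 0 j).
  - rewrite Cmod_pow; replace (Z.abs_nat j) with (Z.to_nat j) by lia.
    apply pow_incr; split; auto using Cmod_ge_0.
  - rewrite <- Cpow_inv, Cmod_pow by auto; replace (Z.abs_nat j) with (Z.to_nat (- j)) by lia.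
    apply pow_incr; split; auto using Cmod_ge_0.
Qed.

(** * Finite sums over lists and absolutely convergent sums over the integers *)

Definition lsum {I : Type} (f : I -> C) (l : list I) : C :=
  fold_right (fun i s => f i + s) 0 l.

Definition rsum {I : Type} (f : I -> R) (l : list I) : R :=
  fold_right (fun i s => f i + s)%R 0%R l.

Lemma lsum_app {I : Type} (f : I -> C) (l m : list I) : lsum f (l ++ m) = lsum f l + lsum f m.
Proof. induction l as [| i l IH]; simpl; [ring | rewrite IH; ring]. Qed.

Lemma rsum_app {I : Type} (f : I -> R) (l m : list I) :
  rsum f (l ++ m) = (rsum f l + rsum f m)%R.
Proof. induction l as [| i l IH]; simpl; [ring | rewrite IH; ring]. Qed.

Lemma lsum_perm {I : Type} (f : I -> C) (l m : list I) : Permutation l m -> lsum f l = lsum f m.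
Proof. induction 1; simpl; try congruence; ring. Qed.

Lemma rsum_perm {I : Type} (f : I -> R) (l m : list I) : Permutation l m -> rsum f l = rsum f m.
Proof. induction 1; simpl; try congruence; ring. Qed.

Lemma lsum_ext {I : Type} (f g : I -> C) (l : list I) :
  (forall i, In i l -> f i = g i) -> lsum f l = lsum g l.
Proof.
  intros H; induction l as [| i l IH]; simpl; auto.
  rewrite IH, H; auto using in_eq, in_cons.
Qed.

Lemma lsum_plus {I : Type} (f g : I -> C) (l : list I) :
  lsum (fun i => f i + g i) l = lsum f l + lsum g l.
Proof. induction l as [| i l IH]; simpl; [ring | rewrite IH; ring]. Qed.

Lemma lsum_scal {I : Type} (c : C) (f : I -> C) (l : list I) :
  lsum (fun i => c * f i) l = c * lsum f l.
Proof. induction l as [| i l IH]; simpl; [ring | rewrite IH; ring]. Qed.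

Lemma rsum_scal {I : Type} (c : R) (f : I -> R) (l : list I) :
  rsum (fun i => c * f i)%R l = (c * rsum f l)%R.
Proof. induction l as [| i l IH]; simpl; [ring | rewrite IH; ring]. Qed.

Lemma lsum_map {I J : Type} (f : J -> C) (g : I -> J) (l : list I) :
  lsum f (map g l) = lsum (fun i => f (g i)) l.
Proof. induction l as [| i l IH]; simpl; congruence. Qed.

Lemma lsum_prod {I J : Type} (f : I -> C) (g : J -> C) (l : list I) (m : list J) :
  lsum (fun ij => f (fst ij) * g (snd ij)) (list_prod l m) = lsum f l * lsum g m.
Proof.
  induction l as [| i l IH]; simpl; [ring |].
  rewrite lsum_app, IH, lsum_map; simpl; rewrite lsum_scal; ring.
Qed.

Lemma rsum_prod {I J : Type} (f : I -> R) (g : J -> R) (l : list I) (m : list J) :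
  rsum (fun ij => f (fst ij) * g (snd ij))%R (list_prod l m) = (rsum f l * rsum g m)%R.
Proof.
  induction l as [| i l IH]; simpl; [ring |].
  rewrite rsum_app, IH; transitivity (rsum (fun j => f i * g j)%R m + rsum f l * rsum g m)%R.
  - f_equal; clear; induction m as [| j m IH]; simpl; congruence.
  - rewrite rsum_scal; ring.
Qed.

Lemma rsum_le {I : Type} (f g : I -> R) (l : list I) :
  (forall i, (f i <= g i)%R) -> (rsum f l <= rsum g l)%R.
Proof.
  intros H; induction l as [| i l IH]; simpl; [lra | pose proof (H i); lra].
Qed.

Lemma Cmod_lsum_le {I : Type} (f : I -> C) (l : list I) :
  (Cmod (lsum f l) <= rsum (fun i => Cmod (f i)) l)%R.
Proof.
  induction l as [| i l IH]; simpl; [rewrite Cmod_0; lra |].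
  eapply Rle_trans; [apply Cmod_triangle | lra].
Qed.

Lemma NoDup_incl_complement {I : Type} (l m : list I) :
  NoDup l -> incl l m -> exists r, Permutation m (l ++ r).
Proof.
  revert m; induction l as [| i l IH]; intros m Hl Hlm.
  - exists m; apply Permutation_refl.
  - inversion Hl as [| i' l' Hi Hl']; subst.
    destruct (in_split i m) as [m1 [m2 ->]]; [apply Hlm, in_eq |].
    destruct (IH (m1 ++ m2)) as [r Hr]; auto.
    + intros k Hk; assert (Hk' := Hlm k (in_cons _ _ _ Hk)).
      apply in_app_iff in Hk'; apply in_app_iff.
      destruct Hk' as [Hk' | [-> | Hk']]; auto; contradiction.
    + exists r; simpl; rewrite <- Hr; symmetry; apply Permutation_middle.
Qed.

(** Up to permutation [m] is [l] followed by the remaining indices, to which the triangle inequality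
    applies. The order and the shape of the index sets do not matter, so this serves both intervals
    and the parity regions of the plane. *)
Lemma lsum_incl_diff {I : Type} (f : I -> C) (l m : list I) : NoDup l -> incl l m ->
  (Cmod (lsum f m - lsum f l)
     <= rsum (fun i => Cmod (f i)) m - rsum (fun i => Cmod (f i)) l)%R.
Proof.
  intros Hl Hlm; destruct (NoDup_incl_complement l m Hl Hlm) as [r Hr].
  rewrite (lsum_perm _ _ _ Hr), (rsum_perm _ _ _ Hr), lsum_app, rsum_app.
  replace (lsum f l + lsum f r - lsum f l) with (lsum f r) by ring.
  pose proof (Cmod_lsum_le f r); lra.
Qed.

Lemma Ccv_lsum {I : Type} (f : nat -> I -> C) (g : I -> C) (l : list I) :
  (forall i, In i l -> Ccv (fun n => f n i) (g i)) -> Ccv (fun n => lsum (f n) l) (lsum g l).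
Proof.
  intros H; induction l as [| i l IH]; simpl; [apply Ccv_const |].
  apply Ccv_plus; [apply H, in_eq | apply IH; auto using in_cons].
Qed.

Fixpoint zbox (N : nat) : list Z :=
  match N with
  | O => [0%Z]
  | S M => Z.of_nat N :: (- Z.of_nat N)%Z :: zbox M
  end.

Lemma In_zbox (N : nat) (j : Z) : In j (zbox N) <-> (Z.abs j <= Z.of_nat N)%Z.
Proof. induction N as [| N IH]; simpl zbox; simpl In; [lia | rewrite IH; lia]. Qed.

Lemma NoDup_zbox (N : nat) : NoDup (zbox N).
Proof.
  induction N as [| N IH]; simpl zbox.
  - constructor; [simpl; tauto | constructor].
  - repeat constructor; auto.
    + simpl In; rewrite In_zbox; lia.
    + rewrite In_zbox; lia.
Qed.

Lemma zbox_incl (N M : nat) : (N <= M)%nat -> incl (zbox N) (zbox M).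
Proof. intros H j; rewrite !In_zbox; lia. Qed.

Lemma lsum_zbox_shift (f : Z -> C) (N : nat) :
  lsum (fun j => f (j + 1)%Z) (zbox N)
  = lsum f (zbox N) + f (Z.of_nat N + 1)%Z - f (- Z.of_nat N)%Z.
Proof.
  induction N as [| N IH]; [simpl; ring |].
  cbn [zbox lsum fold_right]; fold (lsum f (zbox N)) (lsum (fun j => f (j + 1)%Z) (zbox N)).
  rewrite IH; replace (- Z.of_nat (S N) + 1)%Z with (- Z.of_nat N)%Z by lia.
  replace (Z.of_nat N + 1)%Z with (Z.of_nat (S N)) by lia; ring.
Qed.

Definition abs_summable (f : Z -> C) : Prop :=
  exists B : R, forall N, (rsum (fun j => Cmod (f j)) (zbox N) <= B)%R.

Definition zsum (f : Z -> C) : C := limC (fun N => lsum f (zbox N)).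

Lemma abs_summable_lim (f : Z -> C) : abs_summable f ->
  exists A : R, is_lim_seq (fun N => rsum (fun j => Cmod (f j)) (zbox N)) A.
Proof.
  intros [B HB]; apply (ex_finite_lim_seq_incr _ B); auto.
  intros N; simpl zbox; simpl rsum.
  pose proof (Cmod_ge_0 (f (Z.of_nat (S N)))); pose proof (Cmod_ge_0 (f (- Z.of_nat (S N))%Z)).
  simpl in *; lra.
Qed.

Lemma abs_summable_tail (f : Z -> C) (eps : R) : abs_summable f -> (0 < eps)%R ->
  exists K, forall N, (K <= N)%nat ->
    (rsum (fun j => Cmod (f j)) (zbox N) - rsum (fun j => Cmod (f j)) (zbox K) < eps)%R.
Proof.
  intros Hf He; destruct (abs_summable_lim f Hf) as [A HA].
  apply is_lim_seq_spec in HA.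
  destruct (HA (mkposreal (eps / 2) ltac:(lra))) as [K HK]; exists K; intros N HN.
  pose proof (Rabs_def2 _ _ (HK N HN)); pose proof (Rabs_def2 _ _ (HK K (le_n K))).
  simpl in *; lra.
Qed.

Lemma zsum_cv (f : Z -> C) : abs_summable f -> Ccv (fun N => lsum f (zbox N)) (zsum f).
Proof.
  intros Hf; apply cauchy_Ccv_limC; intros eps He.
  destruct (abs_summable_tail f eps Hf He) as [K HK]; exists K; intros N HN.
  eapply Rle_lt_trans; [apply lsum_incl_diff | apply HK, HN].
  - apply NoDup_zbox.
  - now apply zbox_incl.
Qed.

Lemma rsum_incl_diff_scal {I : Type} (f g : I -> C) (W : R) (l m : list I) :
  NoDup l -> incl l m -> (forall i, (Cmod (g i) <= W * Cmod (f i))%R) ->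
  (Cmod (lsum g m - lsum g l)
     <= W * (rsum (fun i => Cmod (f i)) m - rsum (fun i => Cmod (f i)) l))%R.
Proof.
  intros Hl Hlm H; destruct (NoDup_incl_complement l m Hl Hlm) as [r Hr].
  rewrite (lsum_perm _ _ _ Hr), (rsum_perm _ _ _ Hr), lsum_app, rsum_app.
  replace (lsum g l + lsum g r - lsum g l) with (lsum g r) by ring.
  eapply Rle_trans; [apply Cmod_lsum_le |].
  eapply Rle_trans; [apply rsum_le, H |]; rewrite rsum_scal; right; ring.
Qed.

(** Dominated convergence for series: outside a fixed box the absolute sum of [f] is small, and
    inside it the finitely many weights converge. One limit [w0] for all [j] is enough, because the
    central Gaussian binomials share their limit. *)
Lemma tannery (f : Z -> C) (w : nat -> Z -> C) (w0 : C) (W : R) :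
  abs_summable f -> (forall N j, (Cmod (w N j) <= W)%R) ->
  (forall j, Ccv (fun N => w N j) w0) ->
  Ccv (fun N => lsum (fun j => w N j * f j) (zbox N)) (w0 * zsum f).
Proof.
  intros Hf HW Hw.
  assert (HW0 : (0 <= W)%R) by (eapply Rle_trans; [apply (Cmod_ge_0 (w O 0%Z)) | apply HW]).
  pose proof (Cmod_ge_0 w0) as Hw0.
  set (g := fun N j => (w N j - w0) * f j).
  apply (Ccv_ext (fun N => lsum (g N) (zbox N) + w0 * lsum f (zbox N))).
  { intros N; rewrite <- lsum_scal, <- lsum_plus; apply lsum_ext; intros; unfold g; ring. }
  replace (w0 * zsum f) with (0 + w0 * zsum f) by ring.
  apply Ccv_plus; [| apply Ccv_mult; [apply Ccv_const | now apply zsum_cv]].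
  apply Ccv_intro; intros eps He.
  (* [W + Cmod w0] bounds [Cmod (w N j - w0)]; adding 1 makes it a legitimate divisor. *)
  destruct (abs_summable_tail f (eps / 2 / (W + Cmod w0 + 1)) Hf) as [K HK].
  { repeat apply Rdiv_lt_0_compat; lra. }
  assert (Hhead : Ccv (fun N => lsum (g N) (zbox K)) (lsum (fun j => 0 * f j) (zbox K))).
  { apply Ccv_lsum; intros j _; apply Ccv_mult; [| apply Ccv_const].
    replace (RtoC 0) with (w0 - w0) by ring; apply Ccv_minus; auto using Ccv_const. }
  destruct (Ccv_spec _ _ (eps / 2) Hhead ltac:(lra)) as [N1 HN1].
  exists (N1 + K)%nat; intros N HN.
  specialize (HN1 N ltac:(lia)); specialize (HK N ltac:(lia)).
  rewrite lsum_scal in HN1.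
  pose proof (rsum_incl_diff_scal f (g N) (W + Cmod w0 + 1) (zbox K) (zbox N)
                (NoDup_zbox K) (zbox_incl K N ltac:(lia))) as Htail.
  assert (Hg : forall j, (Cmod (g N j) <= (W + Cmod w0 + 1) * Cmod (f j))%R).
  { intros j; unfold g; rewrite Cmod_mult; apply Rmult_le_compat_r; [apply Cmod_ge_0 |].
    pose proof (Cmod_triangle (w N j) (- w0)) as H1; rewrite Cmod_opp in H1.
    pose proof (HW N j); unfold Cminus; lra. }
  specialize (Htail Hg).
  apply (Rmult_lt_compat_l (W + Cmod w0 + 1)) in HK; [| lra].
  replace ((W + Cmod w0 + 1) * (eps / 2 / (W + Cmod w0 + 1)))%R with (eps / 2)%R in HK
    by (field; lra).
  replace (lsum (g N) (zbox N) - 0) with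
    (lsum (g N) (zbox N) - lsum (g N) (zbox K) + (lsum (g N) (zbox K) - 0 * lsum f (zbox K)))
    by ring.
  eapply Rle_lt_trans; [apply Cmod_triangle | lra].
Qed.

(** * The Jacobi triple product *)

Fixpoint ntri (m : nat) : nat :=
  match m with
  | O => O
  | S k => ntri k + k
  end.

Lemma ntri_spec (m : nat) : (2 * Z.of_nat (ntri m) = Z.of_nat m * (Z.of_nat m - 1))%Z.
Proof. induction m as [| m IH]; simpl ntri; nia. Qed.

(** Consecutive terms have ratio [B * rho ^ m], which is below 1/2 from some [K] on. From there the
    partial sum plus its last term no longer increases. *)
Lemma gaussian_sum_bounded (rho B : R) : (0 <= rho < 1)%R -> (0 <= B)%R ->
  exists D : R, forall N, (sum_f_R0 (fun m => rho ^ ntri m * B ^ m) N <= D)%R.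
Proof.
  intros Hr HB; set (a := fun m => (rho ^ ntri m * B ^ m)%R).
  assert (Ha : forall m, (0 <= a m)%R) by (intros m; apply Rmult_le_pos; apply pow_le; lra).
  assert (HS : forall m, a (S m) = (B * rho ^ m * a m)%R)
    by (intros m; unfold a; simpl; rewrite pow_add; ring).
  destruct (is_lim_seq_0_spec _ (/ 2) (pow_scaled_lim rho Hr B) ltac:(lra)) as [K HK].
  exists (sum_f_R0 a K + a K)%R; intros N.
  assert (Hup : forall j, (sum_f_R0 a (K + j) + a (K + j)%nat <= sum_f_R0 a K + a K)%R).
  { induction j as [| j IH]; [rewrite Nat.add_0_r; lra |].
    rewrite Nat.add_succ_r; simpl sum_f_R0; rewrite HS.
    pose proof (HK (K + j)%nat ltac:(lia)) as H1; apply Rabs_def2 in H1.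
    pose proof (Ha (K + j)%nat); nra. }
  destruct (Nat.le_gt_cases K N) as [H | H].
  - pose proof (Hup (N - K)%nat) as H1; replace (K + (N - K))%nat with N in H1 by lia.
    pose proof (Ha N); lra.
  - pose proof (Ha K).
    assert (Hmono : forall j, (sum_f_R0 a N <= sum_f_R0 a (N + j))%R).
    { induction j as [| j IH]; [rewrite Nat.add_0_r; lra |].
      rewrite Nat.add_succ_r; simpl sum_f_R0; pose proof (Ha (S (N + j))); lra. }
    pose proof (Hmono (K - N)%nat) as H1; replace (N + (K - N))%nat with K in H1 by lia; lra.
Qed.

Definition lterm (p : C) (e : Z -> nat) (x : C) (j : Z) : C := p ^ e j * zpow x j.

Lemma Rpow_anti (rho : R) (m n : nat) : (0 <= rho <= 1)%R -> (m <= n)%nat ->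
  (rho ^ n <= rho ^ m)%R.
Proof.
  intros Hr Hmn; replace n with (m + (n - m))%nat by lia; rewrite pow_add.
  assert (0 <= rho ^ m)%R by (apply pow_le; lra).
  assert (rho ^ (n - m) <= 1)%R by (rewrite <- (pow1 (n - m)); apply pow_incr; lra).
  nra.
Qed.

(** The lower bound on [e] is shared by the three quadratic exponents [tri], [sq] and [pronic]; it
    reduces all of them to the Gaussian sum in [Z.abs_nat j]. *)
Lemma lterm_summable (p : C) (e : Z -> nat) (x : C) : (Cmod p < 1)%R -> x <> 0 ->
  (forall j, Z.abs j * (Z.abs j - 1) <= 2 * Z.of_nat (e j))%Z ->
  abs_summable (lterm p e x).
Proof.
  intros Hp Hx He; set (B := Rmax (Cmod x) (Cmod (/ x))).
  assert (HB : (0 <= B)%R)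
    by (eapply Rle_trans; [apply (Cmod_ge_0 x) | apply Rmax_l]).
  assert (Hp0 := Cmod_ge_0 p).
  assert (Hj : forall j, (Cmod (lterm p e x j)
                          <= Cmod p ^ ntri (Z.abs_nat j) * B ^ Z.abs_nat j)%R).
  { intros j; unfold lterm; rewrite Cmod_mult, Cmod_pow.
    apply Rmult_le_compat; auto using pow_le, Cmod_ge_0.
    - apply Rpow_anti; [lra |]; pose proof (ntri_spec (Z.abs_nat j)) as Ht; specialize (He j).
      rewrite Zabs2Nat.id_abs in Ht; lia.
    - apply Cmod_zpow_le; auto; [apply Rmax_l | apply Rmax_r]. }
  destruct (gaussian_sum_bounded (Cmod p) B (conj Hp0 Hp) HB) as [D HD].
  (* The factor 2 accounts for [j] and [- j], which have the same majorant. *)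
  exists (2 * D)%R; intros N.
  eapply Rle_trans; [| apply Rmult_le_compat_l; [lra | apply (HD N)]].
  induction N as [| N IH]; cbn [zbox rsum fold_right].
  - pose proof (Hj 0%Z) as H0; cbn in H0 |- *; lra.
  - fold (rsum (fun j => Cmod (lterm p e x j)) (zbox N)).
    pose proof (Hj (Z.of_nat (S N))) as H1; pose proof (Hj (- Z.of_nat (S N))%Z) as H2.
    replace (Z.abs_nat (- Z.of_nat (S N))) with (S N) in H2 by lia.
    replace (Z.abs_nat (Z.of_nat (S N))) with (S N) in H1 by lia.
    cbn [sum_f_R0]; lra.
Qed.

Definition tri (j : Z) : nat := Z.to_nat (j * (j - 1) / 2).

Lemma tri_spec (j : Z) : (2 * Z.of_nat (tri j) = j * (j - 1))%Z.
Proof.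
  unfold tri; assert (H : (j * (j - 1) mod 2 = 0)%Z).
  { rewrite Zmult_mod, Zminus_mod; pose proof (Z.mod_pos_bound j 2 ltac:(lia)).
    assert (Hj : (j mod 2 = 0 \/ j mod 2 = 1)%Z) by lia.
    destruct Hj as [-> | ->]; reflexivity. }
  pose proof (Z.div_mod (j * (j - 1)) 2 ltac:(lia)).
  assert (0 <= j * (j - 1))%Z by nia.
  rewrite Z2Nat.id by (apply Z.div_pos; lia); lia.
Qed.

Definition qfact (p : C) (n : nat) : C := cprod (fun k => 1 - p ^ S k) n.

Definition qfact_inf (p : C) : C := limC (qfact p).

Lemma one_minus_pow_neq_0 (p : C) (k : nat) : (Cmod p < 1)%R -> 1 - p ^ S k <> 0.
Proof.
  intros Hp H0; assert (H : p ^ S k = 1) by (replace (p ^ S k) with (1 - (1 - p ^ S k)) by ring;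
    rewrite H0; ring).
  pose proof (Cmod_Cpow_S_le p k Hp) as H1; rewrite H, Cmod_1 in H1.
  assert (H2 := f_equal Cmod H); rewrite Cmod_pow, Cmod_1 in H2; simpl in H2.
  pose proof (Rpow_01 (Cmod p) k (conj (Cmod_ge_0 p) Hp)); nra.
Qed.

Lemma qfact_neq_0 (p : C) (n : nat) : (Cmod p < 1)%R -> qfact p n <> 0.
Proof.
  intros Hp; induction n as [| n IH]; [apply C1_neq_0 |].
  apply Cmult_neq_0; auto using one_minus_pow_neq_0.
Qed.

Lemma qfact_cv (p : C) : (Cmod p < 1)%R -> Ccv (qfact p) (qfact_inf p).
Proof.
  intros Hp; refine (cprod_cv (fun k => p ^ S k) 1 (Cmod p) _ _ _);
    [lra | split; auto using Cmod_ge_0 |].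
  intros k; rewrite Rmult_1_l; now apply Cmod_Cpow_S_le.
Qed.

Lemma qfact_inf_neq_0 (p : C) : (Cmod p < 1)%R -> qfact_inf p <> 0.
Proof.
  intros Hp; refine (infinite_product_nonzero (fun k => p ^ S k) 1 (Cmod p) _ _ _ _);
    [lra | split; auto using Cmod_ge_0 | | intros; now apply one_minus_pow_neq_0].
  intros k; rewrite Rmult_1_l; now apply Cmod_Cpow_S_le.
Qed.

(** The value 0 at negative integers imitates a reciprocal gamma function: binomials built from it
    vanish outside their range. *)
Definition rfact (p : C) (n : Z) : C :=
  if (n <? 0)%Z then 0 else / qfact p (Z.to_nat n).

Lemma rfact_neg (p : C) (n : Z) : (n < 0)%Z -> rfact p n = 0.
Proof. intros H; unfold rfact; now apply Z.ltb_lt in H as ->. Qed.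

(** The recursion crosses the boundary: at [n = 0] the factor [1 - p ^ 0] vanishes, and for negative
    [n] both reciprocals do. *)
Lemma rfact_pred (p : C) (n : Z) : (Cmod p < 1)%R ->
  rfact p (n - 1) = rfact p n * (1 - p ^ Z.to_nat n).
Proof.
  intros Hp; destruct (Z.lt_trichotomy n 0) as [H | [-> | H]].
  - rewrite !rfact_neg by lia; ring.
  - rewrite rfact_neg by lia; simpl; ring.
  - unfold rfact; destruct (Z.ltb_spec (n - 1) 0), (Z.ltb_spec n 0); try lia.
    replace (Z.to_nat n) with (S (Z.to_nat (n - 1))) by lia; unfold qfact; cbn [cprod].
    fold (qfact p (Z.to_nat (n - 1))); field; split.
    + now apply one_minus_pow_neq_0.
    + now apply qfact_neq_0.
Qed.

(* The Gaussian binomial coefficient "2N choose N + j" in base [p], extended by zero. *)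
Definition cbinom (p : C) (N : nat) (j : Z) : C :=
  qfact p (2 * N) * (rfact p (Z.of_nat N + j) * rfact p (Z.of_nat N - j)).

Lemma cbinom_out (p : C) (N : nat) (j : Z) : (Z.of_nat N < Z.abs j)%Z -> cbinom p N j = 0.
Proof.
  intros H; unfold cbinom; destruct (Z.le_gt_cases 0 j).
  - rewrite (rfact_neg p (Z.of_nat N - j)) by lia; ring.
  - rewrite (rfact_neg p (Z.of_nat N + j)) by lia; ring.
Qed.

Lemma Cpow_plus_eq (p : C) (a b c d : nat) : (a + b = c + d)%nat -> p ^ a * p ^ b = p ^ c * p ^ d.
Proof. intros H; now rewrite <- !Cpow_add_r, H. Qed.

(** Two Pascal steps at once. [p ^ tri j * cbinom p N j] is to be the coefficient of [(- x) ^ j] in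
    [Epart p x N], and the recurrence is multiplication by the next factor [(1 - x * p ^ N) * (1 - p
    ^ S N / x) = 1 + p ^ (2 * N + 1) - x * p ^ N - p ^ S N / x]. *)
Lemma cbinom_step (p : C) (N : nat) (j : Z) : (Cmod p < 1)%R ->
  p ^ tri j * cbinom p (S N) j
  = p ^ tri j * cbinom p N j * (1 + p ^ (2 * N + 1))
    + p ^ N * p ^ tri (j - 1) * cbinom p N (j - 1)
    + p ^ S N * p ^ tri (j + 1) * cbinom p N (j + 1).
Proof.
  intros Hp; unfold cbinom.
  set (a := (Z.of_nat (S N) + j)%Z); set (b := (Z.of_nat (S N) - j)%Z).
  replace (Z.of_nat N + j)%Z with (a - 1)%Z by lia.
  replace (Z.of_nat N - j)%Z with (b - 1)%Z by lia.
  replace (Z.of_nat N + (j - 1))%Z with (a - 1 - 1)%Z by lia.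
  replace (Z.of_nat N - (j - 1))%Z with b by lia.
  replace (Z.of_nat N + (j + 1))%Z with a by lia.
  replace (Z.of_nat N - (j + 1))%Z with (b - 1 - 1)%Z by lia.
  rewrite !rfact_pred by auto.
  destruct (Z.lt_ge_cases a 0) as [Ha | Ha]; [rewrite (rfact_neg p a) by lia; ring |].
  destruct (Z.lt_ge_cases b 0) as [Hb | Hb]; [rewrite (rfact_neg p b) by lia; ring |].
  replace (qfact p (2 * S N)) with
    (qfact p (2 * N) * (1 - p ^ (2 * N + 1)) * (1 - p ^ Z.to_nat a * p ^ Z.to_nat b)).
  2:{ replace (2 * S N)%nat with (S (S (2 * N))) by lia; unfold qfact; cbn [cprod].
      rewrite <- Cpow_add_r; replace (Z.to_nat a + Z.to_nat b)%nat with (S (S (2 * N))) by lia.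
      now replace (2 * N + 1)%nat with (S (2 * N)) by lia. }
  assert (H1 : p ^ N * p ^ tri (j - 1) = p ^ tri j * p ^ Z.to_nat b).
  { apply Cpow_plus_eq; pose proof (tri_spec j); pose proof (tri_spec (j - 1)); nia. }
  assert (H2 : p ^ S N * p ^ tri (j + 1) = p ^ tri j * p ^ Z.to_nat a).
  { apply Cpow_plus_eq; pose proof (tri_spec j); pose proof (tri_spec (j + 1)); nia. }
  rewrite H1, H2.
  (* For [m = 0] the truncation [Z.to_nat (m - 1) = 0] falsifies the addition of exponents, but then
     [1 - p ^ Z.to_nat m] vanishes. *)
  assert (Hedge : forall m n : Z, (0 <= m)%Z -> (0 <= n)%Z -> (m + n = 2 * Z.of_nat N + 2)%Z ->
    p ^ Z.to_nat n * p ^ Z.to_nat (m - 1) * (1 - p ^ Z.to_nat m)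
    = p ^ (2 * N + 1) * (1 - p ^ Z.to_nat m)).
  { intros m n Hm Hn Hmn; destruct (Z.eq_dec m 0) as [-> | Hm0]; [simpl; ring |].
    rewrite <- Cpow_add_r; do 2 f_equal; lia. }
  pose proof (Hedge a b Ha Hb ltac:(lia)) as H3; pose proof (Hedge b a Hb Ha ltac:(lia)) as H4.
  set (X := p ^ Z.to_nat a) in *; set (Y := p ^ Z.to_nat b) in *.
  set (X' := p ^ Z.to_nat (a - 1)) in *; set (Y' := p ^ Z.to_nat (b - 1)) in *.
  set (s := p ^ (2 * N + 1)) in *; set (c := qfact p (2 * N) * (rfact p a * rfact p b)).
  transitivity (p ^ tri j * c * ((1 + s) * ((1 - X) * (1 - Y))
     + (Y * (1 - X) - Y * X' * (1 - X)) + (X * (1 - Y) - X * Y' * (1 - Y)))).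
  - rewrite H3, H4; unfold c; ring.
  - unfold c; ring.
Qed.

Lemma finite_triple_product (p x : C) (N : nat) : (Cmod p < 1)%R -> x <> 0 ->
  forall M, (N <= M)%nat ->
  lsum (fun j => cbinom p N j * lterm p tri (- x) j) (zbox M) = Epart p x N.
Proof.
  intros Hp Hx; assert (Hx' : - x <> 0).
  { intros H0; apply Hx; replace x with (- - x) by ring; rewrite H0; ring. }
  induction N as [| N IH]; intros M HM.
  - simpl Epart; clear HM; induction M as [| M IH].
    + cbn; unfold cbinom, lterm, rfact, tri, zpow, qfact; simpl; field; apply C1_neq_0.
    + cbn [zbox lsum fold_right]; fold (lsum (fun j => cbinom p 0 j * lterm p tri (- x) j) (zbox M)).
      rewrite IH, !cbinom_out by lia; ring.
  - set (f := fun j => cbinom p N j * lterm p tri (- x) j).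
    transitivity (lsum (fun j => (1 + p ^ (2 * N + 1)) * f j + - (x * p ^ N) * f (j + -1)%Z
                                 + - (p ^ S N / x) * f (j + 1)%Z) (zbox M)).
    + apply lsum_ext; intros j _; unfold f, lterm.
      rewrite (zpow_succ (- x) j), (zpow_pred (- x) j) by auto.
      replace (j + -1)%Z with (j - 1)%Z by lia.
      transitivity (p ^ tri j * cbinom p (S N) j * (- x * zpow (- x) (j - 1))); [ring |].
      rewrite cbinom_step by auto; field; auto.
    + rewrite !lsum_plus, !lsum_scal, lsum_zbox_shift.
      assert (Hsh := lsum_zbox_shift (fun j => f (j + -1)%Z) M); cbv beta in Hsh.
      rewrite (lsum_ext _ f) in Hsh by (intros j _; f_equal; lia).
      replace (lsum (fun j => f (j + -1)%Z) (zbox M)) with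
        (lsum f (zbox M) - f (Z.of_nat M) + f (- Z.of_nat M + -1)%Z)
        by (rewrite Hsh; replace (Z.of_nat M + 1 + -1)%Z with (Z.of_nat M) by lia; ring).
      (* Since [S N <= M], the boundary terms left by the shifts have indices of absolute value [M]
         or [M + 1], outside the support of [cbinom p N]. *)
      unfold f at 3 4 6 7; rewrite !cbinom_out by lia; unfold f; rewrite IH by lia.
      cbn [Epart]; replace (2 * N + 1)%nat with (N + S N)%nat by lia.
      rewrite Cpow_add_r; field; auto.
Qed.

(** Limit of the finite identity by dominated convergence: for fixed [j] the weights [cbinom p N j]
    tend to [/ qfact_inf p], and bounds for [qfact] and its reciprocal bound them uniformly. *)
Lemma triple_product (p x : C) : (Cmod p < 1)%R -> x <> 0 ->
  zsum (lterm p tri (- x)) = qfact_inf p * E p x.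
Proof.
  intros Hp Hx; assert (Hx' : - x <> 0).
  { intros H0; apply Hx; replace x with (- - x) by ring; rewrite H0; ring. }
  pose proof (qfact_inf_neq_0 p Hp) as HP.
  pose proof (qfact_cv p Hp) as Hcv.
  assert (Hinv : Ccv (fun n => / qfact p n) (/ qfact_inf p)) by now apply Ccv_inv.
  destruct (Ccv_bounded _ _ Hcv) as [B1 [HB1 H1]], (Ccv_bounded _ _ Hinv) as [B2 [HB2 H2]].
  assert (Hr : forall n, (Cmod (rfact p n) <= B2)%R).
  { intros n; unfold rfact; destruct (n <? 0)%Z; auto; rewrite Cmod_0; lra. }
  assert (Hlim : Ccv (fun N => lsum (fun j => cbinom p N j * lterm p tri (- x) j) (zbox N))
                   (/ qfact_inf p * zsum (lterm p tri (- x)))).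
  { apply tannery with (B1 * (B2 * B2))%R.
    - apply lterm_summable; auto; intros j; rewrite tri_spec; nia.
    - intros N j; unfold cbinom; rewrite !Cmod_mult.
      apply Rmult_le_compat; auto using Cmod_ge_0, Rmult_le_pos.
      apply Rmult_le_compat; auto using Cmod_ge_0.
    - intros j; replace (/ qfact_inf p) with (qfact_inf p * (/ qfact_inf p * / qfact_inf p))
        by (field; auto).
      assert (Hrf : forall s, Ccv (fun N => rfact p (Z.of_nat N + s)) (/ qfact_inf p)).
      { intros s; apply (Ccv_ext_loc (fun N => / qfact p (Z.to_nat (Z.of_nat N + s)))).
        - exists (Z.abs_nat s); intros n Hn; unfold rfact.
          destruct (Z.ltb_spec (Z.of_nat n + s) 0); auto; lia.
        - apply (Ccv_subseq (fun n => / qfact p n) _ (fun N => Z.to_nat (Z.of_nat N + s))); auto.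
          intros N; exists (N + Z.abs_nat s)%nat; intros n Hn; lia. }
      apply Ccv_mult; [| apply Ccv_mult; apply Hrf].
      apply (Ccv_subseq (qfact p)); auto; intros N; exists N; intros; lia. }
  apply (Ccv_ext _ (Epart p x)) in Hlim; [| intros; now apply finite_triple_product].
  rewrite (Ccv_unique _ _ _ (Epart_cv p x Hp Hx) Hlim); field; auto.
Qed.

(** * Products of two theta functions *)

Definition pairsum (f g : Z -> C) (N : nat) : C :=
  lsum (fun ij => f (fst ij) * g (snd ij)) (list_prod (zbox N) (zbox N)).

Lemma pairsum_cv (f g : Z -> C) : abs_summable f -> abs_summable g ->
  Ccv (pairsum f g) (zsum f * zsum g).
Proof.
  intros Hf Hg; apply (Ccv_ext (fun N => lsum f (zbox N) * lsum g (zbox N))).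
  - intros N; symmetry; apply lsum_prod.
  - apply Ccv_mult; now apply zsum_cv.
Qed.

Lemma NoDup_list_prod {I J : Type} (l : list I) (m : list J) :
  NoDup l -> NoDup m -> NoDup (list_prod l m).
Proof.
  intros Hl Hm; induction Hl as [| i l Hi Hl IH]; simpl; [constructor |].
  apply NoDup_app; auto.
  - apply FinFun.Injective_map_NoDup; auto; intros a b H; congruence.
  - intros [a b] H1 H2; apply in_map_iff in H1; destruct H1 as [c [H1 _]].
    injection H1 as -> ->; apply in_prod_iff in H2; tauto.
Qed.

(** [even_index] and [odd_index] parametrize the pairs [(k, l)] with [k + l] even and odd. The
    offsets are such that [tri k + tri l] becomes [pronic m + sq d] in the even case and
    [sq m + pronic d] in the odd case. *)
Definition even_index (md : Z * Z) : Z * Z :=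
  (fst md + 1 + snd md, fst md + 1 - snd md)%Z.

Definition odd_index (md : Z * Z) : Z * Z :=
  (fst md + snd md + 1, fst md - snd md)%Z.

Definition parity_box (N : nat) : list (Z * Z) :=
  map even_index (list_prod (zbox N) (zbox N)) ++ map odd_index (list_prod (zbox N) (zbox N)).

Lemma NoDup_parity_box (N : nat) : NoDup (parity_box N).
Proof.
  assert (H := NoDup_list_prod _ _ (NoDup_zbox N) (NoDup_zbox N)).
  apply NoDup_app.
  - apply FinFun.Injective_map_NoDup; auto.
    intros [a b] [c d] E0; unfold even_index in E0; simpl in E0; injection E0 as E1 E2.
    f_equal; lia.
  - apply FinFun.Injective_map_NoDup; auto.
    intros [a b] [c d] E0; unfold odd_index in E0; simpl in E0; injection E0 as E1 E2.
    f_equal; lia.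
  - intros [k l] H1 H2; apply in_map_iff in H1, H2.
    destruct H1 as [[a b] [H1 _]], H2 as [[c d] [H2 _]].
    unfold even_index, odd_index in *; simpl in *.
    injection H1 as H1 H1'; injection H2 as H2 H2'; lia.
Qed.

Lemma box_incl_parity_box (N : nat) :
  incl (list_prod (zbox N) (zbox N)) (parity_box (S N)).
Proof.
  intros [k l] H; apply in_prod_iff in H; rewrite !In_zbox in H.
  apply in_app_iff; rewrite !in_map_iff.
  destruct (Z.Even_or_Odd (k + l)) as [[m Hm] | [m Hm]]; [left | right].
  - exists (m - 1, k - m)%Z; split; [unfold even_index; simpl; f_equal; lia |].
    apply in_prod_iff; rewrite !In_zbox; lia.
  - exists (m, m - l)%Z; split; [unfold odd_index; simpl; f_equal; lia |].
    apply in_prod_iff; rewrite !In_zbox; lia.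
Qed.

Lemma parity_box_incl_box (N : nat) :
  incl (parity_box N) (list_prod (zbox (2 * N + 1)) (zbox (2 * N + 1))).
Proof.
  intros [k l] H; apply in_prod_iff; rewrite !In_zbox.
  apply in_app_iff in H; rewrite !in_map_iff in H.
  destruct H as [[[a b] [H1 H2]] | [[a b] [H1 H2]]]; apply in_prod_iff in H2;
    rewrite !In_zbox in H2; unfold even_index, odd_index in H1; simpl in H1;
    injection H1 as H3 H4; lia.
Qed.

(** The parity region lies between two square boxes. The absolute sums over both squares have the
    same limit, so the difference between the region and the inner square contributes nothing in the
    limit. *)
Lemma parity_sum_cv (f g : Z -> C) : abs_summable f -> abs_summable g ->
  Ccv (fun N => lsum (fun ij => f (fst ij) * g (snd ij)) (parity_box (S N))) (zsum f * zsum g).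
Proof.
  intros Hf Hg; set (F := fun ij : Z * Z => f (fst ij) * g (snd ij)).
  set (box := fun N => list_prod (zbox N) (zbox N)).
  set (A := fun N => rsum (fun ij => Cmod (F ij)) (box N)).
  apply (Ccv_ext (fun N => pairsum f g N + (lsum F (parity_box (S N)) - lsum F (box N)))).
  { intros N; unfold pairsum; fold F; fold (box N); ring. }
  replace (zsum f * zsum g) with (zsum f * zsum g + 0) by ring.
  apply Ccv_plus; [now apply pairsum_cv |].
  apply Ccv_le with (fun N => A (2 * S N + 1)%nat - A N)%R.
  - exists O; intros N _; unfold A.
    replace (lsum F (parity_box (S N)) - lsum F (box N) - 0) with
      (lsum F (parity_box (S N)) - lsum F (box N)) by ring.
    eapply Rle_trans; [apply lsum_incl_diff |].
    + apply NoDup_list_prod; apply NoDup_zbox.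
    + apply box_incl_parity_box.
    + pose proof (lsum_incl_diff F _ _ (NoDup_parity_box (S N)) (parity_box_incl_box (S N))) as H.
      pose proof (Cmod_ge_0 (lsum F (list_prod (zbox (2 * S N + 1)) (zbox (2 * S N + 1)))
                             - lsum F (parity_box (S N)))).
      unfold box; lra.
  - destruct (abs_summable_lim f Hf) as [a Ha], (abs_summable_lim g Hg) as [b Hb].
    assert (HA : is_lim_seq A (a * b)%R).
    { apply (is_lim_seq_ext (fun N => rsum (fun j => Cmod (f j)) (zbox N)
                                      * rsum (fun j => Cmod (g j)) (zbox N))%R).
      - intros N; rewrite <- rsum_prod; unfold A, box.
        induction (list_prod (zbox N) (zbox N)) as [| ij l IH]; simpl; auto.
        unfold F at 1; now rewrite Cmod_mult, IH.
      - now apply is_lim_seq_mult'. }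
    replace (Finite 0) with (Finite (a * b - a * b)) by (f_equal; ring).
    apply is_lim_seq_minus'; auto.
    apply (is_lim_seq_subseq A _ (fun N => 2 * S N + 1)%nat); auto.
    apply eventually_subseq; intros; lia.
Qed.

Definition sq (j : Z) : nat := Z.to_nat (j * j).
Definition pronic (j : Z) : nat := Z.to_nat (j * j + j).

Lemma sq_spec (j : Z) : Z.of_nat (sq j) = (j * j)%Z.
Proof. unfold sq; rewrite Z2Nat.id; nia. Qed.

Lemma pronic_spec (j : Z) : Z.of_nat (pronic j) = (j * j + j)%Z.
Proof. unfold pronic; rewrite Z2Nat.id; nia. Qed.

(* Writing [x ^ k * y ^ l] with [k + l] and [k - l] of the same parity separates the variables
   [x y] and [x / y]. *)
Lemma E_mult_separation (p x y : C) : (Cmod p < 1)%R -> x <> 0 -> y <> 0 ->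
  (qfact_inf p * E p x) * (qfact_inf p * E p y)
  = x * y * zsum (lterm p pronic (x * y)) * zsum (lterm p sq (x / y))
    - x * zsum (lterm p sq (x * y)) * zsum (lterm p pronic (x / y)).
Proof.
  intros Hp Hx Hy; rewrite <- !triple_product by auto.
  assert (Hneg : forall t : C, t <> 0 -> - t <> 0).
  { intros t Ht H0; apply Ht; replace t with (- - t) by ring; rewrite H0; ring. }
  assert (Hx' := Hneg x Hx); assert (Hy' := Hneg y Hy).
  assert (Hxy : x * y <> 0) by now apply Cmult_neq_0.
  assert (Hxy' : x / y <> 0) by (apply Cmult_neq_0; auto using Cinv_neq_0).
  assert (HU : x * y = - x * - y) by ring.
  assert (HV : x / y = - x / - y) by (field; auto).
  assert (Htri : forall t : C, t <> 0 -> abs_summable (lterm p tri t)).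
  { intros t Ht; apply lterm_summable; auto; intros j; rewrite tri_spec; nia. }
  assert (Hsq : forall t : C, t <> 0 -> abs_summable (lterm p sq t)).
  { intros t Ht; apply lterm_summable; auto; intros j; rewrite sq_spec; nia. }
  assert (Hpr : forall t : C, t <> 0 -> abs_summable (lterm p pronic t)).
  { intros t Ht; apply lterm_summable; auto; intros j; rewrite pronic_spec; nia. }
  eapply Ccv_unique; [apply parity_sum_cv; auto |].
  apply (Ccv_ext (fun N =>
    x * y * pairsum (lterm p pronic (x * y)) (lterm p sq (x / y)) (S N)
    - x * pairsum (lterm p sq (x * y)) (lterm p pronic (x / y)) (S N))).
  - intros N; unfold parity_box, pairsum; rewrite lsum_app, !lsum_map.
    replace (x * y * lsum _ _) with
      (lsum (fun ij => x * y * (lterm p pronic (x * y) (fst ij) * lterm p sq (x / y) (snd ij)))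
         (list_prod (zbox (S N)) (zbox (S N)))) by apply lsum_scal.
    unfold Cminus; replace (- (x * lsum _ _)) with
      (lsum (fun ij => - x * (lterm p sq (x * y) (fst ij) * lterm p pronic (x / y) (snd ij)))
         (list_prod (zbox (S N)) (zbox (S N)))) by (rewrite lsum_scal; ring).
    f_equal; apply lsum_ext; intros [m d] _; symmetry; unfold even_index, odd_index, lterm; cbn [fst snd].
    + assert (He : p ^ tri (m + 1 + d) * p ^ tri (m + 1 - d) = p ^ pronic m * p ^ sq d).
      { apply Cpow_plus_eq.
        pose proof (tri_spec (m + 1 + d)); pose proof (tri_spec (m + 1 - d)).
        pose proof (sq_spec d); pose proof (pronic_spec m); nia. }
      transitivity ((p ^ pronic m * p ^ sq d) * (zpow (- x) (m + 1 + d) * zpow (- y) (m + 1 - d)));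
        [rewrite <- He; ring |].
      transitivity ((p ^ pronic m * p ^ sq d) * (x * y * zpow (x * y) m * zpow (x / y) d)); [| ring].
      f_equal; rewrite <- zpow_succ by auto; rewrite HU, HV, zpow_mult, zpow_div by auto.
      unfold Z.sub; rewrite (zpow_add (- x) (m + 1) d), (zpow_add (- y) (m + 1) (- d)) by auto; ring.
    + assert (He : p ^ tri (m + d + 1) * p ^ tri (m - d) = p ^ sq m * p ^ pronic d).
      { apply Cpow_plus_eq.
        pose proof (tri_spec (m + d + 1)); pose proof (tri_spec (m - d)).
        pose proof (sq_spec m); pose proof (pronic_spec d); nia. }
      transitivity ((p ^ sq m * p ^ pronic d) * (zpow (- x) (m + d + 1) * zpow (- y) (m - d)));
        [rewrite <- He; ring |].
      transitivity ((p ^ sq m * p ^ pronic d) * (- x * zpow (x * y) m * zpow (x / y) d)); [| ring].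
      f_equal; rewrite HU, HV, zpow_mult, zpow_div, zpow_succ by auto.
      unfold Z.sub; rewrite (zpow_add (- x) m d), (zpow_add (- y) m (- d)) by auto; ring.
  - assert (HS : forall u l, Ccv u l -> Ccv (fun N => u (S N)) l).
    { intros u l Hu; apply (Ccv_subseq u l S); auto; intros N0; exists N0; intros; lia. }
    replace (x * y * zsum (lterm p pronic (x * y)) * zsum (lterm p sq (x / y))
             - x * zsum (lterm p sq (x * y)) * zsum (lterm p pronic (x / y))) with
      (x * y * (zsum (lterm p pronic (x * y)) * zsum (lterm p sq (x / y)))
       - x * (zsum (lterm p sq (x * y)) * zsum (lterm p pronic (x / y)))) by ring.
    apply Ccv_minus; (apply Ccv_mult; [apply Ccv_const |]).
    + apply (HS (pairsum (lterm p pronic (x * y)) (lterm p sq (x / y)))), pairsum_cv; auto.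
    + apply (HS (pairsum (lterm p sq (x * y)) (lterm p pronic (x / y)))), pairsum_cv; auto.
Qed.

(** Substituting [x = A * Y * Z] and [y = Y / Z] in the separated product, the coefficients
    [x * y = A * Y * Y] and [x = A * Y * Z] share [A * Y]; the remaining [Y] or [Z] goes into the
    first coordinate. *)
Definition theta_pair (p A Y : C) : C * C :=
  (Y * zsum (lterm p pronic (A * (Y * Y))), zsum (lterm p sq (A * (Y * Y)))).

Definition cross (v w : C * C) : C := fst v * snd w - snd v * fst w.

Lemma E_mult_cross (p A Y Z : C) : (Cmod p < 1)%R -> A <> 0 -> Y <> 0 -> Z <> 0 ->
  E p (A * Y * Z) * E p (Y / Z)
  = A * Y / (qfact_inf p * qfact_inf p) * cross (theta_pair p A Y) (theta_pair p A Z).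
Proof.
  intros Hp HA HY HZ; pose proof (qfact_inf_neq_0 p Hp) as HP.
  assert (H : A * Y * Z <> 0) by (repeat apply Cmult_neq_0; auto).
  assert (H' : Y / Z <> 0) by (apply Cmult_neq_0; auto using Cinv_neq_0).
  pose proof (E_mult_separation p (A * Y * Z) (Y / Z) Hp H H') as Hsep.
  replace (A * Y * Z * (Y / Z)) with (A * (Y * Y)) in Hsep by (field; auto).
  replace (A * Y * Z / (Y / Z)) with (A * (Z * Z)) in Hsep by (field; auto).
  unfold cross, theta_pair; cbn [fst snd].
  replace (E p (A * Y * Z) * E p (Y / Z)) with
    (qfact_inf p * E p (A * Y * Z) * (qfact_inf p * E p (Y / Z))
     / (qfact_inf p * qfact_inf p)) by (field; auto).
  rewrite Hsep; field; auto.
Qed.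

(** * Elliptic Lagrange interpolation *)

Lemma cprod_mult (f g : nat -> C) (n : nat) :
  cprod (fun i => f i * g i) n = cprod f n * cprod g n.
Proof. induction n as [| n IH]; simpl; [ring | rewrite IH; ring]. Qed.

Lemma cprod_neq_0 (f : nat -> C) (n : nat) :
  (forall i, (i < n)%nat -> f i <> 0) -> cprod f n <> 0.
Proof.
  intros H; induction n as [| n IH]; simpl; [apply C1_neq_0 |].
  apply Cmult_neq_0; auto.
Qed.

Lemma cprod_div (f g : nat -> C) (n : nat) : (forall i, (i < n)%nat -> g i <> 0) ->
  cprod (fun i => f i / g i) n = cprod f n / cprod g n.
Proof.
  intros Hg; induction n as [| n IH]; simpl; [field; apply C1_neq_0 |].
  rewrite IH by auto; field; split; [apply Hg; lia | apply cprod_neq_0; auto].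
Qed.

Lemma cprod_add (f : nat -> C) (m n : nat) :
  cprod f (m + n) = cprod f m * cprod (fun i => f (m + i)%nat) n.
Proof.
  induction n as [| n IH]; simpl; [rewrite Nat.add_0_r; ring |].
  rewrite Nat.add_succ_r; simpl; rewrite IH; ring.
Qed.

Lemma sum_upto_ext (f g : nat -> C) (n : nat) :
  (forall k, (k <= n)%nat -> f k = g k) -> sum_upto f n = sum_upto g n.
Proof.
  intros H; induction n as [| n IH]; simpl; [now apply H |].
  rewrite IH, H by auto; reflexivity.
Qed.

Lemma sum_upto_scal (c : C) (f : nat -> C) (n : nat) :
  sum_upto (fun k => c * f k) n = c * sum_upto f n.
Proof. induction n as [| n IH]; simpl; [reflexivity | rewrite IH; ring]. Qed.

Lemma sum_upto_plus (f g : nat -> C) (n : nat) :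
  sum_upto (fun k => f k + g k) n = sum_upto f n + sum_upto g n.
Proof. induction n as [| n IH]; simpl; [reflexivity | rewrite IH; ring]. Qed.

Definition skip (k : nat) (f : nat -> C) (i : nat) : C := if (i =? k)%nat then 1 else f i.

Lemma cprod_skip_ge (k : nat) (f : nat -> C) (n : nat) : (n <= k)%nat ->
  cprod (skip k f) n = cprod f n.
Proof.
  intros H; apply cprod_ext; intros i Hi; unfold skip.
  destruct (Nat.eqb_spec i k); auto; lia.
Qed.

Lemma cprod_skip (k : nat) (f : nat -> C) (n : nat) : (k <= n)%nat ->
  cprod (skip k f) (S n) = cprod f k * cprod (fun i => f (S k + i)%nat) (n - k).
Proof.
  intros H; replace (S n) with (S k + (n - k))%nat by lia.
  rewrite cprod_add; cbn [cprod]; rewrite cprod_skip_ge by lia.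
  unfold skip at 1; rewrite Nat.eqb_refl, Cmult_1_r; f_equal.
  apply cprod_ext; intros i _; unfold skip; destruct (Nat.eqb_spec (S k + i) k); auto; lia.
Qed.

Lemma cprod_skip_mult (k : nat) (f : nat -> C) (n : nat) : (k < n)%nat ->
  cprod (skip k f) n * f k = cprod f n.
Proof.
  intros H; destruct n as [| n]; [lia |]; rewrite cprod_skip by lia.
  replace (cprod f (S n)) with (cprod f (S k + (n - k))) by (f_equal; lia).
  rewrite cprod_add; simpl; ring.
Qed.

Lemma cprod_skip_div (k : nat) (f g : nat -> C) (n : nat) :
  cprod (skip k (fun i => f i / g i)) n = cprod (skip k f) n * cprod (skip k (fun i => / g i)) n.
Proof.
  rewrite <- cprod_mult; apply cprod_ext; intros i _; unfold skip.
  destruct (i =? k)%nat; unfold Cdiv; ring.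
Qed.

Lemma cross_antisym (v w : C * C) : cross v w = - cross w v.
Proof. unfold cross; ring. Qed.

Definition lagrange_term (n : nat) (Y c : nat -> C * C) (y : C * C) (k : nat) : C :=
  cprod (fun j => cross (Y j) (c k)) n
  * cprod (skip k (fun i => cross (c i) y / cross (c i) (c k))) (S n).

(** Multiplication by [cross (c k) y] restores the numerator factor skipped at [i = k], after which
    [y] occurs only in the full product over the nodes. The form without division admits points [y]
    that are nodes. *)
Lemma lagrange_term_change_point (n : nat) (Y c : nat -> C * C) (y z : C * C) (k : nat) :
  (k <= n)%nat ->
  lagrange_term n Y c y k * cross (c k) y * cprod (fun i => cross (c i) z) (S n)
  = lagrange_term n Y c z k * cross (c k) z * cprod (fun i => cross (c i) y) (S n).
Proof.
  intros Hk; unfold lagrange_term; rewrite !cprod_skip_div.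
  rewrite <- (cprod_skip_mult k (fun i => cross (c i) y)) by lia.
  rewrite <- (cprod_skip_mult k (fun i => cross (c i) z)) by lia; ring.
Qed.

(* The points are homogeneous coordinates on the projective line, so no point at infinity is
   excluded and [cross v w] plays the role of a difference. *)
Lemma lagrange_interpolation (n : nat) (Y c : nat -> C * C) (y : C * C) :
  (forall i j, (i <= n)%nat -> (j <= n)%nat -> i <> j -> cross (c i) (c j) <> 0) ->
  sum_upto (lagrange_term n Y c y) n = cprod (fun j => cross (Y j) y) n.
Proof.
  revert y; induction n as [| n IH]; intros y Hc.
  - unfold lagrange_term, skip; simpl; ring.
  - assert (IH' : forall z, sum_upto (lagrange_term n Y c z) n = cprod (fun j => cross (Y j) z) n)
      by (intros z; apply IH; intros; apply Hc; auto); clear IH.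
    set (d := c (S n)); set (v := Y n).
    set (Py := cprod (fun i => cross (c i) y) (S n)).
    set (Pd := cprod (fun i => cross (c i) d) (S n)).
    assert (HPd : Pd <> 0) by (apply cprod_neq_0; intros i Hi; apply Hc; lia).
    cbn [sum_upto cprod]; fold v.
    (* Each term with the new node [d] and the new point [v] splits into old terms at [y] and at
       [d]. The induction hypothesis sums both families, and the part coming from [d] cancels
       against the term [k = S n]. *)
    rewrite (sum_upto_ext _ (fun k => cross v y * lagrange_term n Y c y k
                                      + - (cross v d * Py / Pd) * lagrange_term n Y c d k)).
    + rewrite sum_upto_plus, !sum_upto_scal, !IH'.
      unfold lagrange_term at 1; fold d; rewrite cprod_skip, Nat.sub_diag by lia.
      cbn [cprod]; fold v.
      replace (cprod (fun i => cross (c i) y / cross (c i) d) n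
                 * (cross (c n) y / cross (c n) d)) with (Py / Pd).
      { field; auto. }
      change (Py / Pd = cprod (fun i => cross (c i) y / cross (c i) d) (S n)).
      symmetry; apply cprod_div; intros; apply Hc; lia.
    + intros k Hk.
      assert (Hdk : cross d (c k) <> 0) by (apply Hc; lia).
      assert (HT : lagrange_term (S n) Y c y k
        = lagrange_term n Y c y k * (cross v (c k) * cross d y / cross d (c k))).
      { unfold lagrange_term; set (F := fun i => cross (c i) y / cross (c i) (c k)).
        transitivity (cprod (fun j => cross (Y j) (c k)) n * cross v (c k)
                      * (cprod (skip k F) (S n) * skip k F (S n))); [reflexivity |].
        replace (skip k F (S n)) with (cross d y / cross d (c k)); [unfold Cdiv; ring |].
        unfold skip; destruct (Nat.eqb_spec (S n) k); [lia | reflexivity]. }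
      rewrite HT.
      (* Plücker relation for the four vectors [v], [d], [c k], [y]. *)
      replace (cross v (c k) * cross d y) with
        (cross v y * cross d (c k) + cross v d * cross (c k) y) by (unfold cross; ring).
      assert (Hch := lagrange_term_change_point n Y c y d k Hk); fold Py Pd in Hch.
      rewrite (cross_antisym (c k) d) in Hch.
      transitivity (lagrange_term n Y c y k * cross v y
        + cross v d * (lagrange_term n Y c y k * cross (c k) y * Pd) / (Pd * cross d (c k)));
        [field; auto |].
      rewrite Hch; field; auto.
Qed.

Definition Epair (p A Y Z : C) : C := E p (A * Y * Z) * E p (Y / Z).

(** Each [Epair p A u v] is a determinant times [A * u / P]. For [u = Y j] this factor comes out of
    the sum as [S0], present on both sides; for [u = c i] it cancels between numerator and
    denominator. *)
Lemma elliptic_interpolation (p A : C) (n : nat) (Y c : nat -> C) (y : C) :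
  (Cmod p < 1)%R -> A <> 0 -> y <> 0 -> (forall j, Y j <> 0) -> (forall i, c i <> 0) ->
  (forall i j, (i <= n)%nat -> (j <= n)%nat -> i <> j -> Epair p A (c i) (c j) <> 0) ->
  sum_upto (fun k => cprod (fun j => Epair p A (Y j) (c k)) n
    * cprod (skip k (fun i => Epair p A (c i) y / Epair p A (c i) (c k))) (S n)) n
  = cprod (fun j => Epair p A (Y j) y) n.
Proof.
  intros Hp HA Hy HY Hc Hne; set (P := qfact_inf p * qfact_inf p).
  assert (HP : P <> 0) by (apply Cmult_neq_0; now apply qfact_inf_neq_0).
  assert (HR : forall u v : C, u <> 0 -> v <> 0 ->
    Epair p A u v = A * u / P * cross (theta_pair p A u) (theta_pair p A v))
    by (intros; now apply E_mult_cross).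
  assert (Hcr : forall i j, (i <= n)%nat -> (j <= n)%nat -> i <> j ->
    cross (theta_pair p A (c i)) (theta_pair p A (c j)) <> 0).
  { intros i j Hi Hj Hij H0; apply (Hne i j Hi Hj Hij); rewrite HR, H0 by auto; ring. }
  set (S0 := cprod (fun j => A * Y j / P) n).
  rewrite (cprod_ext (fun j => Epair p A (Y j) y)
             (fun j => A * Y j / P * cross (theta_pair p A (Y j)) (theta_pair p A y)))
    by (intros; auto).
  rewrite cprod_mult; fold S0.
  rewrite <- (lagrange_interpolation n (fun j => theta_pair p A (Y j))
                (fun i => theta_pair p A (c i))) by auto.
  rewrite <- sum_upto_scal; apply sum_upto_ext; intros k Hk; unfold lagrange_term.
  rewrite (cprod_ext (fun j => Epair p A (Y j) (c k))
             (fun j => A * Y j / P * cross (theta_pair p A (Y j)) (theta_pair p A (c k))))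
    by (intros; auto).
  rewrite cprod_mult; fold S0; rewrite <- Cmult_assoc; do 2 f_equal.
  apply cprod_ext; intros i Hi; unfold skip; destruct (Nat.eqb_spec i k) as [| Hik]; auto.
  rewrite !HR by auto; field; repeat split; auto.
  apply Hcr; lia.
Qed.

(** * Elliptic shifted factorials *)

Lemma epoch_cprod (p Q x : C) (m : nat) : epoch p Q x m = cprod (fun i => E p (x * Q ^ i)) m.
Proof. induction m as [| m IH]; simpl; congruence. Qed.

Lemma epoch_add (p Q x : C) (m n : nat) :
  epoch p Q x (m + n) = epoch p Q x m * epoch p Q (x * Q ^ m) n.
Proof.
  rewrite !epoch_cprod, cprod_add; f_equal; apply cprod_ext; intros i _.
  rewrite Cpow_add_r; f_equal; ring.
Qed.

Lemma epoch_S_front (p Q x : C) (n : nat) : epoch p Q x (S n) = E p x * epoch p Q (x * Q) n.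
Proof.
  replace (S n) with (1 + n)%nat by lia; rewrite epoch_add; simpl.
  rewrite !Cmult_1_r; ring.
Qed.

Lemma epoch_prefix_neq_0 (p Q x : C) (m n : nat) : (m <= n)%nat ->
  epoch p Q x n <> 0 -> epoch p Q x m <> 0.
Proof.
  intros H Hn H0; apply Hn; replace n with (m + (n - m))%nat by lia.
  rewrite epoch_add, H0; ring.
Qed.

Lemma epoch_factor_neq_0 (p Q x : C) (i n : nat) : (i < n)%nat ->
  epoch p Q x n <> 0 -> E p (x * Q ^ i) <> 0.
Proof.
  intros H Hn H0; apply (epoch_prefix_neq_0 p Q x (S i) n H Hn); simpl; rewrite H0; ring.
Qed.

Lemma cprod_rev (f : nat -> C) (n : nat) : cprod (fun i => f (n - 1 - i)%nat) n = cprod f n.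
Proof.
  induction n as [| n IH]; auto.
  replace (S n) with (1 + n)%nat by lia; rewrite cprod_add.
  transitivity (f n * cprod f n).
  - f_equal; [cbn [cprod]; rewrite Cmult_1_l; f_equal; lia |].
    rewrite <- IH; apply cprod_ext; intros i Hi; f_equal; lia.
  - simpl; ring.
Qed.

Lemma epoch_rev (p Q x : C) (n : nat) : Q <> 0 ->
  epoch p Q (x * Q / Q ^ n) n = cprod (fun i => E p (x / Q ^ i)) n.
Proof.
  intros HQ; rewrite epoch_cprod, <- cprod_rev; apply cprod_ext; intros i Hi.
  f_equal; replace n with (S (i + (n - 1 - i)))%nat at 1 by lia.
  rewrite Cpow_S, Cpow_add_r; field; repeat split; auto using Cpow_nz.
Qed.

Lemma cprod_const (x : C) (n : nat) : cprod (fun _ => x) n = x ^ n.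
Proof. induction n as [| n IH]; simpl; [reflexivity | rewrite IH; ring]. Qed.

Lemma epoch_inv (p Q x : C) (n : nat) : (Cmod p < 1)%R -> Q <> 0 -> x <> 0 ->
  epoch p Q (/ x) n = cprod (fun i => - (Q ^ i / x)) n * epoch p Q (x * Q / Q ^ n) n.
Proof.
  intros Hp HQ Hx; rewrite epoch_rev, epoch_cprod, <- cprod_mult by auto.
  apply cprod_ext; intros i _.
  assert (HQi : Q ^ i <> 0) by now apply Cpow_nz.
  assert (Hxi : x / Q ^ i <> 0) by (apply Cmult_neq_0; auto using Cinv_neq_0).
  replace (/ x * Q ^ i) with (/ (x / Q ^ i)) by (field; auto).
  rewrite E_inv by auto; field; auto.
Qed.

(** Inverting the argument costs a monomial prefactor, and the prefactors for [x] and [x * t] differ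
    by [t ^ n]. Cross-multiplied, the relation needs no nonvanishing of theta values. *)
Lemma epoch_inv_scale (p Q x t : C) (n : nat) :
  (Cmod p < 1)%R -> Q <> 0 -> x <> 0 -> t <> 0 ->
  epoch p Q (/ (x * t)) n * t ^ n * epoch p Q (x * Q / Q ^ n) n
  = epoch p Q (/ x) n * epoch p Q (x * t * Q / Q ^ n) n.
Proof.
  intros Hp HQ Hx Ht; rewrite !epoch_inv by (auto using Cmult_neq_0).
  replace (cprod (fun i => - (Q ^ i / x)) n) with
    (cprod (fun i => - (Q ^ i / (x * t))) n * t ^ n); [ring |].
  rewrite <- cprod_const, <- cprod_mult; apply cprod_ext; intros i _; field; auto.
Qed.

(** The square of the reflection of [epoch p Q (/ Q ^ k) k]; squaring removes the sign and the
    halved exponent [k * (k + 1) / 2]. *)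
Lemma epoch_inv_reflect (p Q : C) (k : nat) : (Cmod p < 1)%R -> Q <> 0 ->
  epoch p Q (/ Q ^ k) k * epoch p Q (/ Q ^ k) k * Q ^ (k + k * k)
  = epoch p Q Q k * epoch p Q Q k.
Proof.
  intros Hp HQ; induction k as [| k IH]; [simpl; ring |].
  assert (HQk : Q ^ S k <> 0) by now apply Cpow_nz.
  assert (HQk' : Q ^ k <> 0) by now apply Cpow_nz.
  rewrite epoch_S_front; cbn [epoch].
  replace (/ Q ^ S k * Q) with (/ Q ^ k) by (rewrite Cpow_S; field; auto).
  rewrite E_inv by auto; rewrite <- Cpow_S.
  replace (S k + S k * S k)%nat with (k + k * k + S k + S k)%nat by lia.
  rewrite (Cpow_add_r Q (k + k * k + S k)), (Cpow_add_r Q (k + k * k)).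
  transitivity (E p (Q ^ S k) * E p (Q ^ S k)
    * (epoch p Q (/ Q ^ k) k * epoch p Q (/ Q ^ k) k * Q ^ (k + k * k))); [field; auto |].
  rewrite IH; ring.
Qed.

Lemma Cdiv_eq_cross (x y z w : C) : y <> 0 -> w <> 0 -> x * w = z * y -> x / y = z / w.
Proof.
  intros Hy Hw H; replace (x / y) with (x * w / (y * w)) by (field; auto).
  rewrite H; field; auto.
Qed.

Lemma Cmult_neq_0_l (x y : C) : x * y <> 0 -> x <> 0.
Proof. intros H H0; apply H; rewrite H0; ring. Qed.

Lemma Cmult_neq_0_r (x y : C) : x * y <> 0 -> y <> 0.
Proof. intros H H0; apply H; rewrite H0; ring. Qed.

(** Both ratios come from splitting [epoch p q x (m + n)] after [n] or after [m] factors. With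
    [m = r * k] a length depending on [k] is traded for [n], the number of interpolated factors. *)
Lemma epoch_shift_ratio (p q x t : C) (m n : nat) : t = q ^ m ->
  epoch p q x n <> 0 -> epoch p q x m <> 0 ->
  epoch p q (x * q ^ n) m / epoch p q x m = epoch p q (x * t) n / epoch p q x n.
Proof.
  intros -> Hn Hm; apply Cdiv_eq_cross; auto.
  pose proof (epoch_add p q x n m) as H1; pose proof (epoch_add p q x m n) as H2.
  rewrite Nat.add_comm, H2 in H1.
  transitivity (epoch p q x n * epoch p q (x * q ^ n) m); [ring |].
  rewrite <- H1; ring.
Qed.

Lemma epoch_shift_ratio_inv (p q x : C) (m n : nat) : (Cmod p < 1)%R -> q <> 0 -> x <> 0 ->
  epoch p q (/ x) n <> 0 -> epoch p q (x * q / q ^ n) m <> 0 ->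
  epoch p q (x * q) m / epoch p q (x * q / q ^ n) m
  = epoch p q (/ (x * q ^ m)) n * q ^ (m * n) / epoch p q (/ x) n.
Proof.
  intros Hp Hq Hx Hn Hm.
  assert (Hqn : q ^ n <> 0) by now apply Cpow_nz.
  assert (Hqm : q ^ m <> 0) by now apply Cpow_nz.
  assert (Hw : epoch p q (x * q / q ^ n) n <> 0).
  { rewrite epoch_inv in Hn by auto; eapply Cmult_neq_0_r, Hn. }
  replace (x * q) with (x * q / q ^ n * q ^ n) at 1 by (field; auto).
  rewrite (epoch_shift_ratio p q _ (q ^ m)) by auto.
  apply Cdiv_eq_cross; auto.
  replace (x * q / q ^ n * q ^ m) with (x * q ^ m * q / q ^ n) by (field; auto).
  rewrite Cpow_mult_r, epoch_inv_scale by auto; ring.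
Qed.

(** The numerator on the right is the product of [E p (x * Q ^ i)] over [i <= n] without [i = k],
    the shape of a Lagrange numerator; the new denominator is independent of [k]. *)
Lemma epoch_telescope_ratio (p Q x : C) (k n : nat) : (k <= n)%nat ->
  epoch p Q (x * Q) n <> 0 ->
  epoch p Q x k / epoch p Q (x * Q) k
  = epoch p Q x k * epoch p Q (x * Q ^ S k) (n - k) / epoch p Q (x * Q) n.
Proof.
  intros Hk Hn; apply Cdiv_eq_cross; auto; [now apply (epoch_prefix_neq_0 _ _ _ k n) |].
  replace n with (k + (n - k))%nat at 1 by lia; rewrite epoch_add, Cpow_S.
  replace (x * Q * Q ^ k) with (x * (Q * Q ^ k)) by ring; ring.
Qed.

(** [epoch p Q A (S n + k)] is split after [S n] factors and, alternatively, around the factor of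
    index [2 * k]. The right-hand denominators are the parts [E p (A * Q ^ (k + i))], [i <> k], of
    the node differences. *)
Lemma very_well_poised_ratio (p Q A : C) (k n : nat) : (k <= n)%nat ->
  epoch p Q A (2 * n + 1) <> 0 ->
  E p (A * Q ^ (2 * k)) * epoch p Q A k / (E p A * epoch p Q (A * Q ^ S n) k)
  = epoch p Q (A * Q) n
    / (epoch p Q (A * Q ^ k) k * epoch p Q (A * Q ^ k * Q ^ S k) (n - k)).
Proof.
  intros Hk HA.
  assert (H1 : epoch p Q A (S n) = E p A * epoch p Q (A * Q) n) by apply epoch_S_front.
  assert (H2 : epoch p Q A (S n + k) = epoch p Q A (S n) * epoch p Q (A * Q ^ S n) k)
    by apply epoch_add.
  assert (H3 : epoch p Q A (S n + k)
    = epoch p Q A k * (epoch p Q (A * Q ^ k) k * E p (A * Q ^ (2 * k))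
        * epoch p Q (A * Q ^ k * Q ^ S k) (n - k))).
  { replace (S n + k)%nat with (k + (S k + (n - k)))%nat by lia.
    rewrite epoch_add, (epoch_add p Q (A * Q ^ k) (S k)); cbn [epoch].
    replace (2 * k)%nat with (k + k)%nat by lia.
    rewrite Cpow_add_r, (Cmult_assoc A); ring. }
  assert (H4 : epoch p Q A (S n + k) <> 0)
    by (apply (epoch_prefix_neq_0 _ _ _ _ (2 * n + 1)); auto; lia).
  assert (H5 := H4); rewrite H2, H1 in H4; rewrite H3 in H5.
  apply Cdiv_eq_cross.
  - apply Cmult_neq_0; [apply (Cmult_neq_0_l _ (epoch p Q (A * Q) n)) |];
      [apply (Cmult_neq_0_l _ _ H4) | apply (Cmult_neq_0_r _ _ H4)].
  - pose proof (Cmult_neq_0_r _ _ H5) as H6.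
    apply Cmult_neq_0; [| exact (Cmult_neq_0_r _ _ H6)].
    exact (Cmult_neq_0_l _ _ (Cmult_neq_0_l _ _ H6)).
  - transitivity (epoch p Q A (S n + k)); [rewrite H3; ring | rewrite H2, H1; ring].
Qed.

(** The right-hand denominators are the other parts [E p (Q ^ i / Q ^ k)] of the node differences,
    for [i < k] and [i > k]. The power [Q ^ (k * n)] is the one that [epoch_shift_ratio_inv]
    produces for [m = r * k]. *)
Lemma terminating_ratio (p Q : C) (k n : nat) : (Cmod p < 1)%R -> Q <> 0 -> (k <= n)%nat ->
  epoch p Q Q n <> 0 ->
  epoch p Q (/ Q ^ n) k * Q ^ k * Q ^ (k * n) / epoch p Q Q k
  = epoch p Q Q n / (epoch p Q (/ Q ^ k) k * epoch p Q Q (n - k)).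
Proof.
  intros Hp HQ Hk Hn.
  assert (HQk : Q ^ k <> 0) by now apply Cpow_nz.
  assert (Hk0 : epoch p Q Q k <> 0) by now apply (epoch_prefix_neq_0 _ _ _ k n).
  assert (Hnk : epoch p Q Q (n - k) <> 0) by (apply (epoch_prefix_neq_0 _ _ _ _ n); auto; lia).
  pose proof (epoch_inv_reflect p Q k Hp HQ) as Hrefl.
  assert (Hi : epoch p Q (/ Q ^ k) k <> 0).
  { intros H0; apply (Cmult_neq_0 _ _ Hk0 Hk0); rewrite <- Hrefl, H0; ring. }
  assert (Hsplit : epoch p Q Q n = epoch p Q Q (n - k) * epoch p Q (Q ^ (n - k) * Q) k).
  { replace n with (n - k + k)%nat at 1 by lia; rewrite epoch_add; f_equal; f_equal; ring. }
  assert (Hsc := epoch_inv_scale p Q (Q ^ k) (Q ^ (n - k)) k Hp HQ HQk ltac:(now apply Cpow_nz)).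
  rewrite <- Cpow_add_r in Hsc; replace (k + (n - k))%nat with n in Hsc by lia.
  replace (Q ^ k * Q / Q ^ k) with Q in Hsc by (field; auto).
  replace (Q ^ n * Q / Q ^ k) with (Q ^ (n - k) * Q) in Hsc.
  2:{ replace n with (n - k + k)%nat at 2 by lia; rewrite Cpow_add_r; field; auto. }
  apply Cdiv_eq_cross; auto using Cmult_neq_0.
  rewrite Hsplit.
  set (X := epoch p Q (/ Q ^ k) k) in *; set (Z := epoch p Q Q k) in *.
  replace (Q ^ k * Q ^ (k * n)) with (Q ^ (k + k * k) * (Q ^ (n - k)) ^ k) in *.
  2:{ rewrite <- Cpow_mult_r, <- !Cpow_add_r; f_equal; nia. }
  (* Multiplying and dividing by [Z] produces [X * X], so that the squared reflection applies. *)
  assert (Hgoal : epoch p Q (/ Q ^ n) k * (Q ^ (n - k)) ^ k * X * Q ^ (k + k * k)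
                  = epoch p Q (Q ^ (n - k) * Q) k * Z).
  { replace (epoch p Q (/ Q ^ n) k * (Q ^ (n - k)) ^ k * X * Q ^ (k + k * k)) with
      (epoch p Q (/ Q ^ n) k * (Q ^ (n - k)) ^ k * Z * (X * Q ^ (k + k * k)) / Z)
      by (field; auto).
    rewrite Hsc.
    replace (X * epoch p Q (Q ^ (n - k) * Q) k * (X * Q ^ (k + k * k)) / Z) with
      (epoch p Q (Q ^ (n - k) * Q) k * (X * X * Q ^ (k + k * k)) / Z) by (field; auto).
    rewrite Hrefl; field; auto. }
  transitivity (epoch p Q Q (n - k) * (epoch p Q (/ Q ^ n) k * (Q ^ (n - k)) ^ k * X * Q ^ (k + k * k)));
    [| rewrite Hgoal; ring].
  rewrite <- (Cmult_assoc (epoch p Q (/ Q ^ n) k)).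
  replace (Q ^ k * Q ^ (k * n)) with (Q ^ (k + k * k) * (Q ^ (n - k)) ^ k); [ring |].
  rewrite <- Cpow_mult_r, <- !Cpow_add_r; f_equal; nia.
Qed.

(** * The series as an interpolation sum *)

Definition summand (p q a b c : C) (r n k : nat) : C :=
  let Q := q ^ r in
  E p (a * b * Q ^ (2 * k)) * epoch p Q (a * b) k
    / (E p (a * b) * epoch p Q (a * b * Q ^ S n) k)
  * (epoch p Q c k / epoch p Q (c * Q) k)
  * (epoch p Q (a * b / c) k / epoch p Q (a * b / c * Q) k)
  * (epoch p q (b * q) (r * k) / epoch p q (b * q / q ^ n) (r * k))
  * (epoch p q (a * q ^ n) (r * k) / epoch p q a (r * k))
  * (epoch p Q (/ Q ^ n) k * Q ^ k / epoch p Q Q k).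

Definition closed_form (p q a b c : C) (r n : nat) : C :=
  let Q := q ^ r in
  epoch p q (a / c) n * epoch p q (c / b) n * (epoch p Q Q n * epoch p Q (a * b * Q) n)
  / (epoch p Q (c * Q) n * epoch p Q (a * b / c * Q) n * (epoch p q a n * epoch p q (/ b) n)).

Lemma E_Qpow_diff_neq_0 (p Q : C) (i j n : nat) : (Cmod p < 1)%R -> Q <> 0 ->
  epoch p Q Q n <> 0 -> (i <= n)%nat -> (j <= n)%nat -> i <> j -> E p (Q ^ i / Q ^ j) <> 0.
Proof.
  intros Hp HQ Hn Hi Hj Hij.
  assert (Hpow : forall m, Q ^ m <> 0) by (intros; now apply Cpow_nz).
  assert (Hpos : forall m, (0 < m <= n)%nat -> E p (Q ^ m) <> 0).
  { intros m Hm; destruct m as [| m]; [lia |]; rewrite Cpow_S.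
    apply (epoch_factor_neq_0 p Q Q m n); auto; lia. }
  destruct (Nat.lt_ge_cases i j) as [H | H].
  - replace (Q ^ i / Q ^ j) with (/ Q ^ (j - i)).
    + rewrite E_inv by auto; intros H0; apply (Hpos (j - i)%nat ltac:(lia)).
      replace (E p (Q ^ (j - i))) with (- Q ^ (j - i) * - (E p (Q ^ (j - i)) / Q ^ (j - i)))
        by (field; auto).
      rewrite H0; ring.
    + replace j with (i + (j - i))%nat at 2 by lia; rewrite Cpow_add_r; field; auto.
  - replace (Q ^ i / Q ^ j) with (Q ^ (i - j)); [apply Hpos; lia |].
    replace i with (j + (i - j))%nat at 2 by lia; rewrite Cpow_add_r; field; auto.
Qed.

(** The length [2 * n + 1] covers every index [i + j] with [i, j <= n], so that all node differences
    are nonzero. [D] collects what depends neither on [k] nor on the interpolated product: the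
    closed form is [D] times that product at [/ c], and [D] times each Lagrange term is a
    [summand]. *)
Lemma sum_closed_form_generic (p q a b c : C) (r n : nat) :
  (Cmod p < 1)%R -> q <> 0 -> a <> 0 -> b <> 0 -> c <> 0 ->
  epoch p (q ^ r) (a * b) (2 * n + 1) <> 0 -> epoch p (q ^ r) (q ^ r) n <> 0 ->
  epoch p (q ^ r) (c * q ^ r) n <> 0 -> epoch p (q ^ r) (a * b / c * q ^ r) n <> 0 ->
  epoch p q a n <> 0 -> epoch p q (/ b) n <> 0 ->
  epoch p q a (r * n) <> 0 -> epoch p q (b * q / q ^ n) (r * n) <> 0 ->
  sum_upto (summand p q a b c r n) n = closed_form p q a b c r n.
Proof.
  intros Hp Hq Ha Hb Hc HA HQn Hcn HAcn Han Hbn Harn Hbrn.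
  set (Q := q ^ r) in *; set (A := a * b) in *.
  assert (HQ : Q <> 0) by now apply Cpow_nz.
  assert (HA0 : A <> 0) by now apply Cmult_neq_0.
  assert (Hpow : forall m, Q ^ m <> 0) by (intros; now apply Cpow_nz).
  assert (Hqpow : forall m, q ^ m <> 0) by (intros; now apply Cpow_nz).
  assert (Hpair : forall i j, (i <= n)%nat -> (j <= n)%nat -> i <> j ->
    Epair p A (Q ^ i) (Q ^ j) <> 0).
  { intros i j Hi Hj Hij; apply Cmult_neq_0; [| now apply (E_Qpow_diff_neq_0 p Q i j n)].
    rewrite <- Cmult_assoc, <- Cpow_add_r.
    apply (epoch_factor_neq_0 p Q A (i + j) (2 * n + 1)); auto; lia. }
  pose proof (elliptic_interpolation p A n (fun j => q ^ j / b) (fun i => Q ^ i) (/ c) Hp HA0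
    ltac:(now apply Cinv_neq_0) ltac:(intros; apply Cmult_neq_0; auto using Cinv_neq_0)
    Hpow Hpair) as Hint; cbv beta in Hint.
  set (D := epoch p Q Q n * epoch p Q (A * Q) n
    / (epoch p Q (c * Q) n * epoch p Q (A / c * Q) n * (epoch p q a n * epoch p q (/ b) n))).
  replace (closed_form p q a b c r n) with
    (D * cprod (fun j => Epair p A (q ^ j / b) (/ c)) n).
  2:{ unfold closed_form; fold Q A.
      replace (cprod (fun j => Epair p A (q ^ j / b) (/ c)) n) with
        (epoch p q (a / c) n * epoch p q (c / b) n); [unfold D; field; auto |].
      rewrite !epoch_cprod, <- cprod_mult; apply cprod_ext; intros j _; unfold Epair, A.
      f_equal; f_equal; field; auto. }
  rewrite <- Hint, <- sum_upto_scal; apply sum_upto_ext; intros k Hk.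
  rewrite cprod_skip by lia.
  rewrite !cprod_div by (intros; apply Hpair; lia).
  replace (cprod (fun j => Epair p A (q ^ j / b) (Q ^ k)) n) with
    (epoch p q (a * Q ^ k) n * epoch p q (/ (b * Q ^ k)) n).
  2:{ rewrite !epoch_cprod, <- cprod_mult; apply cprod_ext; intros j _; unfold Epair, A.
      f_equal; f_equal; field; auto. }
  replace (cprod (fun i => Epair p A (Q ^ i) (/ c)) k) with
    (epoch p Q (A / c) k * epoch p Q c k).
  2:{ rewrite !epoch_cprod, <- cprod_mult; apply cprod_ext; intros j _; unfold Epair, A.
      f_equal; f_equal; field; auto. }
  replace (cprod (fun i => Epair p A (Q ^ (S k + i)) (/ c)) (n - k)) with
    (epoch p Q (A / c * Q ^ S k) (n - k) * epoch p Q (c * Q ^ S k) (n - k)).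
  2:{ rewrite !epoch_cprod, <- cprod_mult; apply cprod_ext; intros j _; unfold Epair, A.
      rewrite Cpow_add_r; f_equal; f_equal; field; auto. }
  replace (cprod (fun i => Epair p A (Q ^ i) (Q ^ k)) k) with
    (epoch p Q (A * Q ^ k) k * epoch p Q (/ Q ^ k) k).
  2:{ rewrite !epoch_cprod, <- cprod_mult; apply cprod_ext; intros j _; unfold Epair, A.
      f_equal; f_equal; field; auto. }
  replace (cprod (fun i => Epair p A (Q ^ (S k + i)) (Q ^ k)) (n - k)) with
    (epoch p Q (A * Q ^ k * Q ^ S k) (n - k) * epoch p Q Q (n - k)).
  2:{ rewrite !epoch_cprod, <- cprod_mult; apply cprod_ext; intros j _; unfold Epair, A.
      rewrite Cpow_add_r, Cpow_S; f_equal; f_equal; field; auto. }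
  assert (Hrk : q ^ (r * k) = Q ^ k) by apply Cpow_mult_r.
  assert (HrkK : (r * k <= r * n)%nat) by nia.
  unfold summand; fold Q A.
  rewrite very_well_poised_ratio, (epoch_telescope_ratio p Q c k n),
    (epoch_telescope_ratio p Q (A / c) k n) by auto.
  rewrite (epoch_shift_ratio p q a (Q ^ k))
    by (auto; now apply (epoch_prefix_neq_0 _ _ _ _ (r * n))).
  rewrite epoch_shift_ratio_inv by (auto; now apply (epoch_prefix_neq_0 _ _ _ _ (r * n))).
  rewrite Hrk; replace (q ^ (r * k * n)) with (Q ^ (k * n))
    by (rewrite <- Nat.mul_assoc; symmetry; apply Cpow_mult_r).
  pose proof (terminating_ratio p Q k n Hp HQ Hk HQn) as Hterm.
  assert (HQk : epoch p Q Q k <> 0) by now apply (epoch_prefix_neq_0 _ _ _ k n).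
  assert (HQnk : epoch p Q Q (n - k) <> 0) by (apply (epoch_prefix_neq_0 _ _ _ _ n); auto; lia).
  assert (Hden1 : epoch p Q (A * Q ^ k) k <> 0 /\ epoch p Q (A * Q ^ k * Q ^ S k) (n - k) <> 0).
  { split; rewrite epoch_cprod; apply cprod_neq_0; intros i Hi; rewrite <- !Cmult_assoc,
      <- !Cpow_add_r; apply (epoch_factor_neq_0 p Q A _ (2 * n + 1)); auto; lia. }
  assert (Hden2 : epoch p Q (/ Q ^ k) k <> 0).
  { intros H0; apply (Cmult_neq_0 _ _ HQk HQk).
    rewrite <- epoch_inv_reflect, H0 by auto; ring. }
  destruct Hden1 as [Hd1 Hd2].
  set (t := epoch p Q (/ Q ^ n) k * Q ^ k / epoch p Q Q k).
  assert (Ht : t * Q ^ (k * n) = epoch p Q Q n / (epoch p Q (/ Q ^ k) k * epoch p Q Q (n - k)))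
    by (rewrite <- Hterm; unfold t; field; auto).
  replace t with (epoch p Q Q n / (epoch p Q (/ Q ^ k) k * epoch p Q Q (n - k)) / Q ^ (k * n))
    by (rewrite <- Ht; field; auto).
  unfold D; field; repeat split; auto.
Qed.

(** * Merging parameters in base [q ^ r] into factorials in base [q] *)

Lemma epochs_app (p Q : C) (l m : list C) (k : nat) :
  epochs p Q (l ++ m) k = epochs p Q l k * epochs p Q m k.
Proof.
  induction l as [| x l IH]; simpl; [ring |].
  unfold epochs in *; rewrite IH; ring.
Qed.

Lemma epochs_map_seq (p Q : C) (f : nat -> C) (r k : nat) :
  epochs p Q (map f (seq 0 r)) k = cprod (fun j => epoch p Q (f j) k) r.
Proof.
  induction r as [| r IH]; [reflexivity |].
  rewrite seq_S, map_app, epochs_app, IH; simpl; ring.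
Qed.

(** By division with remainder, the exponents [r * i + j] with [j < r] and [i < k] run once through
    [0, ..., r * k - 1]. *)
Lemma epoch_interleave (p q x : C) (r k : nat) :
  cprod (fun j => epoch p (q ^ r) (x * q ^ j) k) r = epoch p q x (r * k).
Proof.
  induction k as [| k IH].
  - rewrite Nat.mul_0_r; simpl; rewrite cprod_const; apply Cpow_1_l.
  - rewrite Nat.mul_succ_r, epoch_add, <- IH, (epoch_cprod p q), <- cprod_mult.
    apply cprod_ext; intros j _; simpl; f_equal; f_equal.
    rewrite Cpow_mult_r; ring.
Qed.

Lemma epochs_thm41_params (p q a b c : C) (r n k : nat) :
  epochs p (q ^ r) (thm41_params q a b c r n) k
  = epoch p (q ^ r) c k * epoch p (q ^ r) (a * b / c) k * epoch p q (b * q) (r * k)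
    * epoch p q (a * q ^ n) (r * k) * epoch p (q ^ r) (/ (q ^ r) ^ n) k.
Proof.
  unfold thm41_params; rewrite !epochs_app, !epochs_map_seq.
  rewrite <- (epoch_interleave p q (b * q)), <- (epoch_interleave p q (a * q ^ n)).
  rewrite (cprod_ext (fun j => epoch p (q ^ r) (b * q ^ S j) k)
             (fun j => epoch p (q ^ r) (b * q * q ^ j) k))
    by (intros; f_equal; rewrite Cpow_S; ring).
  rewrite (cprod_ext (fun j => epoch p (q ^ r) (a * q ^ (n + j)) k)
             (fun j => epoch p (q ^ r) (a * q ^ n * q ^ j) k))
    by (intros; f_equal; rewrite Cpow_add_r; ring).
  rewrite Cpow_mult_r; simpl; ring.
Qed.

Lemma omega_den_thm41_params (p q a b c : C) (r n k : nat) :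
  q <> 0 -> a <> 0 -> b <> 0 -> c <> 0 ->
  omega_den p (q ^ r) (a * b) (thm41_params q a b c r n) k
  = epoch p (q ^ r) (q ^ r) k * epoch p (q ^ r) (a * b / c * q ^ r) k
    * epoch p (q ^ r) (c * q ^ r) k * epoch p q a (r * k)
    * epoch p q (b * q / q ^ n) (r * k) * epoch p (q ^ r) (a * b * (q ^ r) ^ S n) k.
Proof.
  intros Hq Ha Hb Hc; assert (Hqp : forall m, q ^ m <> 0) by (intros; now apply Cpow_nz).
  unfold omega_den, thm41_params; rewrite !map_app, !map_map, !epochs_app, !epochs_map_seq.
  rewrite <- (epoch_interleave p q a), <- (epoch_interleave p q (b * q / q ^ n)).
  (* The map [x -> a * b * q ^ r / x] sends the parameters built from [b] to ones built from [a] and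
     conversely, reversing the order of [j]. *)
  rewrite <- (cprod_rev (fun j => epoch p (q ^ r) (a * q ^ j) k)).
  rewrite <- (cprod_rev (fun j => epoch p (q ^ r) (b * q / q ^ n * q ^ j) k)).
  assert (Hr : forall j, (j < r)%nat -> q ^ r = q * q ^ j * q ^ (r - 1 - j)).
  { intros j Hj; rewrite <- Cpow_S, <- Cpow_add_r; f_equal; lia. }
  rewrite (cprod_ext (fun j => epoch p (q ^ r) (a * b * q ^ r / (b * q ^ S j)) k)
             (fun j => epoch p (q ^ r) (a * q ^ (r - 1 - j)) k)).
  2:{ intros j Hj; f_equal; rewrite (Hr j Hj), Cpow_S; field; auto. }
  rewrite (cprod_ext (fun j => epoch p (q ^ r) (a * b * q ^ r / (a * q ^ (n + j))) k)
             (fun j => epoch p (q ^ r) (b * q / q ^ n * q ^ (r - 1 - j)) k)).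
  2:{ intros j Hj; f_equal; rewrite (Hr j Hj), Cpow_add_r; field; auto. }
  cbn [map epochs fold_right].
  replace (a * b * q ^ r / c) with (a * b / c * q ^ r) by (field; auto).
  replace (a * b * q ^ r / (a * b / c)) with (c * q ^ r) by (field; auto).
  replace (a * b * q ^ r / / q ^ (r * n)) with (a * b * (q ^ r) ^ S n)
    by (rewrite Cpow_mult_r, Cpow_S; field; auto using Cpow_nz).
  ring.
Qed.

Lemma omega_term_thm41_params (p q a b c : C) (r n k : nat) :
  q <> 0 -> a <> 0 -> b <> 0 -> c <> 0 -> E p (a * b) <> 0 ->
  omega_den p (q ^ r) (a * b) (thm41_params q a b c r n) k <> 0 ->
  omega_term p (q ^ r) (a * b) (thm41_params q a b c r n) k = summand p q a b c r n k.
Proof.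
  intros Hq Ha Hb Hc HE Hden; unfold omega_term, summand.
  rewrite omega_den_thm41_params in * by auto; rewrite epochs_thm41_params.
  repeat match goal with
  | H : Cmult _ _ <> _ |- _ =>
      pose proof (Cmult_neq_0_l _ _ H); pose proof (Cmult_neq_0_r _ _ H); clear H
  end.
  field; repeat split; auto.
Qed.

(** * Degenerate parameters *)

(* The moduli of the zeros of [E p] are the integer powers of [Cmod p]. *)
Lemma zero_moduli_separated (rho s t : R) :
  (0 <= rho < 1)%R -> (0 < s < t)%R ->
  (exists k, s * rho ^ k = 1 \/ s = rho ^ S k)%R ->
  (exists k, t * rho ^ k = 1 \/ t = rho ^ S k)%R -> (s <= rho * t)%R.
Proof.
  intros Hr Hst [k Hk] [l Hl].
  assert (H01 := fun m => Rpow_01 rho m Hr).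
  assert (Hsmall : forall m, (rho ^ S m <= rho)%R)
    by (intros m; simpl; pose proof (H01 m); nra).
  (* A modulus of the first kind is at least 1, one of the second kind at most [rho]. So one mixed
     case contradicts [s < t] and the other gives [s <= rho <= rho * t]; in the unmixed cases the
     exponents differ by at least one. *)
  destruct Hk as [Hk | Hk], Hl as [Hl | Hl].
  - destruct (Nat.le_gt_cases l k) as [H | H].
    + pose proof (Rpow_anti rho l k ltac:(lra) H); pose proof (H01 l).
      assert (Hl0 : (0 < rho ^ l)%R) by nra.
      assert (s * rho ^ k <= s * rho ^ l)%R by (apply Rmult_le_compat_l; lra).
      assert (s * rho ^ l < t * rho ^ l)%R by (apply Rmult_lt_compat_r; lra); lra.
    + replace l with (k + S (l - S k))%nat in Hl by lia; rewrite pow_add in Hl.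
      pose proof (H01 k); pose proof (Hsmall (l - S k)%nat).
      assert (Hk0 : (0 < rho ^ k)%R) by nra.
      assert (Hs : s = (t * rho ^ S (l - S k))%R)
        by (apply (Rmult_eq_reg_r (rho ^ k)); nra).
      rewrite Hs; nra.
  - pose proof (Hsmall l); pose proof (H01 k); nra.
  - pose proof (Hsmall k); pose proof (H01 l).
    assert (0 <= t * (1 - rho ^ l))%R by (apply Rmult_le_pos; lra).
    assert (0 <= rho * (t - 1))%R by (apply Rmult_le_pos; lra); lra.
  - destruct (Nat.le_gt_cases k l) as [H | H].
    + pose proof (Rpow_anti rho (S k) (S l) ltac:(lra) ltac:(lia)); lra.
    + pose proof (Rpow_anti rho (S (S l)) (S k) ltac:(lra) ltac:(lia)) as H1.
      rewrite Hk, Hl; exact H1.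
Qed.

(** A positive real factor changes only the modulus, and strictly monotonically in [m]; knowing the
    moduli of the zeros of [E] is then enough to avoid them. *)
Definition perturbation (m : nat) : C := RtoC (1 + / INR (S m)).

Lemma perturbation_lim : is_lim_seq (fun m => 1 + / INR (S m))%R 1%R.
Proof.
  replace (Finite 1) with (Finite (1 + 0)) by (f_equal; ring).
  apply is_lim_seq_plus'; [apply is_lim_seq_const |].
  apply (is_lim_seq_incr_1 (fun m => / INR m)%R).
  replace (Finite 0) with (Rbar_inv p_infty) by reflexivity.
  apply is_lim_seq_inv; [apply is_lim_seq_INR | discriminate].
Qed.

Lemma perturbation_cv : Ccv perturbation 1.
Proof.
  apply Ccv_le with (fun m => 1 + / INR (S m) - 1)%R.
  - exists O; intros m _; unfold perturbation; rewrite <- RtoC_minus, Cmod_R.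
    assert (0 < / INR (S m))%R by (apply Rinv_0_lt_compat, lt_0_INR; lia).
    rewrite Rabs_pos_eq; lra.
  - replace (Finite 0) with (Finite (1 - 1)) by (f_equal; ring).
    apply is_lim_seq_minus'; [apply perturbation_lim | apply is_lim_seq_const].
Qed.

(** Moduli of distinct zeros differ at least by the factor [Cmod p], whereas for [m >= N] the moduli
    of [x * perturbation m] lie too close together for that. Hence at most one such [m] gives a
    zero. *)
Lemma E_perturbation_neq_0 (p x : C) : (Cmod p < 1)%R -> x <> 0 ->
  eventually (fun m => E p (x * perturbation m) <> 0).
Proof.
  intros Hp Hx; assert (Hr : (0 <= Cmod p < 1)%R) by (split; auto using Cmod_ge_0).
  assert (Hx0 : (0 < Cmod x)%R) by now apply Cmod_gt_0.
  assert (Hpert : forall m, (0 < / INR (S m))%R)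
    by (intros; apply Rinv_0_lt_compat, lt_0_INR; lia).
  assert (HN : exists N, forall m, (N <= m)%nat -> (Cmod p * (1 + / INR (S m)) < 1)%R).
  { assert (H := is_lim_seq_mult' _ _ _ _ (is_lim_seq_const (Cmod p)) perturbation_lim).
    apply is_lim_seq_spec in H.
    destruct (H (mkposreal (1 - Cmod p) ltac:(lra))) as [N HN]; exists N; intros m Hm.
    specialize (HN m Hm); apply Rabs_def2 in HN; simpl in *; lra. }
  destruct HN as [N HN].
  assert (Hmod : forall m, Cmod (x * perturbation m) = (Cmod x * (1 + / INR (S m)))%R).
  { intros m; unfold perturbation; rewrite Cmod_mult, Cmod_R, Rabs_pos_eq; auto.
    pose proof (Hpert m); lra. }
  assert (Hzero : forall m, E p (x * perturbation m) = 0 -> exists k,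
    (Cmod x * (1 + / INR (S m)) * Cmod p ^ k = 1
     \/ Cmod x * (1 + / INR (S m)) = Cmod p ^ S k)%R).
  { intros m H0; destruct (E_zero p (x * perturbation m) Hp) as [k Hk]; auto.
    - intros H1; apply (f_equal Cmod) in H1; rewrite Hmod, Cmod_0 in H1.
      pose proof (Hpert m); nra.
    - exists k; rewrite <- Hmod, <- !Cmod_pow, <- Cmod_mult.
      destruct Hk as [-> | ->]; [left; apply Cmod_1 | right; reflexivity]. }
  assert (Hone : forall m l, (N <= m < l)%nat -> E p (x * perturbation m) = 0 ->
    E p (x * perturbation l) <> 0).
  { intros m l Hml Hm Hl.
    assert (Hlt : (/ INR (S l) < / INR (S m))%R).
    { apply Rinv_lt_contravar; [apply Rmult_lt_0_compat; apply lt_0_INR; lia |].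
      apply lt_INR; lia. }
    pose proof (Hpert l); pose proof (HN m ltac:(lia)).
    assert (Hsep := zero_moduli_separated (Cmod p) (Cmod x * (1 + / INR (S l)))
                      (Cmod x * (1 + / INR (S m))) Hr ltac:(split; nra)
                      (Hzero l Hl) (Hzero m Hm)).
    assert (Cmod x * (Cmod p * (1 + / INR (S m))) < Cmod x * 1)%R
      by (apply Rmult_lt_compat_l; auto).
    nra. }
  destruct (classic (exists m, (N <= m)%nat /\ E p (x * perturbation m) = 0)) as [[m [Hm H0]] | Hn].
  - exists (S m); intros l Hl; apply (Hone m l); auto; lia.
  - exists N; intros m Hm H0; apply Hn; now exists m.
Qed.

Lemma Ccv_epoch (p Q : C) (u : nat -> C) (l : C) (k : nat) :
  (Cmod p < 1)%R -> Q <> 0 -> l <> 0 -> Ccv u l ->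
  Ccv (fun m => epoch p Q (u m) k) (epoch p Q l k).
Proof.
  intros Hp HQ Hl Hu; induction k as [| k IH]; simpl; [apply Ccv_const |].
  apply Ccv_mult; auto; apply E_continuous; auto using Cmult_neq_0, Cpow_nz.
  apply Ccv_mult; auto using Ccv_const.
Qed.

Lemma Ccv_sum_upto (f : nat -> nat -> C) (g : nat -> C) (n : nat) :
  (forall k, (k <= n)%nat -> Ccv (fun m => f m k) (g k)) ->
  Ccv (fun m => sum_upto (f m) n) (sum_upto g n).
Proof.
  intros H; induction n as [| n IH]; simpl; [now apply H |].
  apply Ccv_plus; auto.
Qed.

Lemma epoch_perturbation_neq_0 (p Q x : C) (k : nat) : (Cmod p < 1)%R -> Q <> 0 -> x <> 0 ->
  eventually (fun m => epoch p Q (x * perturbation m) k <> 0).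
Proof.
  intros Hp HQ Hx; induction k as [| k IH]; simpl.
  - exists O; intros _ _; apply C1_neq_0.
  - assert (H : eventually (fun m => E p (x * Q ^ k * perturbation m) <> 0))
      by (apply E_perturbation_neq_0; auto using Cmult_neq_0, Cpow_nz).
    apply (filter_and _ _ IH) in H; revert H; apply filter_imp; intros m [H1 H2].
    apply Cmult_neq_0; auto.
    replace (x * perturbation m * Q ^ k) with (x * Q ^ k * perturbation m) by ring; auto.
Qed.

Ltac Ccv_step :=
  match goal with
  | |- Ccv (fun _ => ?x) _ => apply Ccv_const
  | |- Ccv (fun m => Cdiv _ _) _ => apply Ccv_div
  | |- Ccv (fun m => Cmult _ _) _ => apply Ccv_mult
  | |- Ccv (fun m => epoch _ _ _ _) _ => apply Ccv_epoch
  | |- Ccv (fun m => E _ _) _ => apply E_continuous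
  | |- Cmult _ _ <> _ => apply Cmult_neq_0
  end.

(* The interpolation nodes collide when [E p (a b Q ^ i) = 0] for some [1 <= i <= n], which the
   hypotheses allow; these cases are limits of the generic one under [a -> a (1 + 1 / m)]. *)
Lemma sum_closed_form (p q a b c : C) (r n : nat) :
  (Cmod p < 1)%R -> q <> 0 -> a <> 0 -> b <> 0 -> c <> 0 ->
  E p (a * b) <> 0 ->
  epoch p (q ^ r) (q ^ r) n <> 0 -> epoch p (q ^ r) (a * b * (q ^ r) ^ S n) n <> 0 ->
  epoch p (q ^ r) (c * q ^ r) n <> 0 -> epoch p (q ^ r) (a * b / c * q ^ r) n <> 0 ->
  epoch p q a n <> 0 -> epoch p q (/ b) n <> 0 ->
  epoch p q a (r * n) <> 0 -> epoch p q (b * q / q ^ n) (r * n) <> 0 ->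
  sum_upto (summand p q a b c r n) n = closed_form p q a b c r n.
Proof.
  intros Hp Hq Ha Hb Hc HE HQn HAn Hcn HAcn Han Hbn Harn Hbrn.
  assert (HQ : q ^ r <> 0) by now apply Cpow_nz.
  assert (Hpow : forall m, (q ^ r) ^ m <> 0) by (intros; now apply Cpow_nz).
  assert (Hqpow : forall m, q ^ m <> 0) by (intros; now apply Cpow_nz).
  assert (Hprefix : forall Q x k m, (k <= m)%nat -> epoch p Q x m <> 0 -> epoch p Q x k <> 0)
    by (intros; eapply epoch_prefix_neq_0; eauto).
  set (u := fun m => a * perturbation m).
  assert (Hu : Ccv u a).
  { replace a with (a * 1) by ring; apply Ccv_mult; [apply Ccv_const | apply perturbation_cv]. }
  assert (Hab : a * b <> 0) by now apply Cmult_neq_0.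
  assert (Habc : a * b / c <> 0) by (apply Cmult_neq_0; auto using Cinv_neq_0).
  assert (Hac : a / c <> 0) by (apply Cmult_neq_0; auto using Cinv_neq_0).
  assert (Hmul : forall x y : C, x <> 0 -> y <> 0 -> x * y <> 0) by (intros; now apply Cmult_neq_0).
  (* A vanishing [E p (a * b * (q ^ r) ^ i)] with [1 <= i <= n] enters [summand] and [closed_form]
     only through numerators, so both remain continuous at [a]. *)
  assert (Hcv : Ccv (fun m => sum_upto (summand p q (u m) b c r n) n)
                  (sum_upto (summand p q a b c r n) n)).
  { apply Ccv_sum_upto; intros k Hk.
    assert (HkQ := Hprefix _ _ _ _ Hk HQn); assert (HkA := Hprefix _ _ _ _ Hk HAn).
    assert (Hkc := Hprefix _ _ _ _ Hk Hcn); assert (HkAc := Hprefix _ _ _ _ Hk HAcn).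
    assert (Hrk : (r * k <= r * n)%nat) by nia.
    assert (Hka := Hprefix _ _ _ _ Hrk Harn); assert (Hkb := Hprefix _ _ _ _ Hrk Hbrn).
    unfold summand.
    repeat Ccv_step; auto. }
  assert (Hcv' : Ccv (fun m => closed_form p q (u m) b c r n) (closed_form p q a b c r n)).
  { unfold closed_form.
    repeat Ccv_step; auto. }
  apply (Ccv_unique _ _ _ Hcv); revert Hcv'; apply Ccv_ext_loc.
  assert (Hev : forall (Q x : C) (k : nat), Q <> 0 -> x <> 0 ->
    eventually (fun m => epoch p Q (x * perturbation m) k <> 0))
    by (intros; now apply epoch_perturbation_neq_0).
  (* The generic conditions that involve [a] are restored for large [m]; the others do not change
     under the perturbation. *)
  pose proof (Hev (q ^ r) (a * b) (2 * n + 1)%nat HQ Hab) as H1.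
  pose proof (Hev (q ^ r) (a * b / c * q ^ r) n HQ (Hmul _ _ Habc HQ)) as H2.
  pose proof (Hev q a n Hq Ha) as H3; pose proof (Hev q a (r * n)%nat Hq Ha) as H4.
  pose proof (filter_and _ _ (filter_and _ _ H1 H2) (filter_and _ _ H3 H4)) as H5.
  pose proof (filter_and _ _ H5 (Ccv_nonzero u a Ha Hu)) as H6.
  revert H6; apply filter_imp; intros m [[[G1 G2] [G3 G4]] G5].
  symmetry; apply sum_closed_form_generic; auto.
  - replace (u m * b) with (a * b * perturbation m) by (unfold u; ring); exact G1.
  - replace (u m * b / c * q ^ r) with (a * b / c * q ^ r * perturbation m)
      by (unfold u; field; auto); exact G2.
Qed.

Theorem theorem4p1 (p q a b c : C) (r n : nat) :
  Cmod p < 1 -> q <> 0 -> a <> 0 -> b <> 0 -> c <> 0 -> (0 < r)%nat ->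
  (* genericity: no denominator vanishes *)
  E p (a * b) <> 0 ->
  (forall k, (k <= n)%nat -> omega_den p (q ^ r) (a * b) (thm41_params q a b c r n) k <> 0) ->
  epochs p (q ^ r) [c * q ^ r; a * b * q ^ r / c] n <> 0 ->
  epochs p q [a; / b] n <> 0 ->
  omega p (q ^ r) (a * b) (thm41_params q a b c r n) n
  = epochs p q [a / c; c / b] n * epochs p (q ^ r) [q ^ r; a * b * q ^ r] n
    / (epochs p (q ^ r) [c * q ^ r; a * b * q ^ r / c] n * epochs p q [a; / b] n).
Proof.
  intros Hp Hq Ha Hb Hc _ HE Hden Hcn Habn; unfold omega.
  rewrite (sum_upto_ext _ (summand p q a b c r n))
    by (intros k Hk; apply omega_term_thm41_params; auto).
  (* The factorials in the denominator at [k = n] contain those for smaller [k] as prefixes. *)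
  specialize (Hden n (le_n n)); rewrite omega_den_thm41_params in Hden by auto.
  cbn [epochs fold_right] in *; rewrite !Cmult_1_r in *.
  replace (a * b * q ^ r / c) with (a * b / c * q ^ r) in * by (field; auto).
  repeat match goal with
  | H : Cmult _ _ <> _ |- _ =>
      pose proof (Cmult_neq_0_l _ _ H); pose proof (Cmult_neq_0_r _ _ H); clear H
  end.
  rewrite sum_closed_form by auto; reflexivity.
Qed.
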